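(* Let $a,b,c:\mathbb{R}\to\mathbb{C}$ be locally operator-Lipschitz functions, and let $(X_t)_{t\in[0,t_0)}$ be a self-adjoint solution, bounded in operator norm for all $t\in[0,t_0)$, of the free stochastic differential equation $$dX_t=a(X_t)\,dt+b(X_t)(dW_t)c(X_t),$$ where $W_t$ is the free Brownian motion. For $z\in\mathbb{C}\setminus\mathbb{R}$ let $G_t=G_t(z)=(X_t-z)^{-1}$ be the resolvent of $X_t$ and $g_t=g_t(z)=E[G_t(z)]$ its expectation, and write $a_t=a(X_t)$, $b_t=b(X_t)$, $c_t=c(X_t)$. Then for all $t\in[0,t_0)$, $$\frac{dg_t}{dt}=-E(a_tG_t^2)+E(b_tc_tG_t)\,E(b_tc_tG_t^2).$$
   Context: $(\mathcal{A},E)$ is a $W^*$-probability space: a von Neumann algebra $\mathcal{A}$ with a faithful normal tracial state $E$; $\|\cdot\|$ is the operator norm. Freeness is in the sense of Voiculescu. Free Brownian motion (Wigner process): a family of self-adjoint operators $W_t\in\mathcal{A}$, $t\ge 0$, with $W_0=0$, such that for $t>s$ the increment $W_t-W_s$ is free from the past and has the semicircle distribution with mean $0$ and variance $t-s$. ''The past'' is described by a filtration: an increasing family of von Neumann subalgebras $\mathcal{A}_t\subset\mathcal{A}$ with $W_t\in\mathcal{A}_t$ and $W_t-W_s$ free from $\mathcal{A}_s$ for $t>s$. Initial values $X_0$ belong to $\mathcal{A}_0$. Free stochastic integral: if $t\mapsto u_t,v_t$ are norm-continuous, norm-bounded and adapted ($u_t,v_t\in\mathcal{A}_t$), then $\int_p^q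 u_t(dW_t)v_t$ is the operator-norm limit of the sums $\sum_i u_{\tau_i}(W_{t_i}-W_{t_{i-1}})v_{\tau_i}$ over partitions $p=t_0\le\dots\le t_n=q$ and points $p\le\tau_i\le t_{i-1}$, as $\max_i(t_i-\tau_i)\to0$. (The limit exists and is independent of choices.) A function $f:\mathbb{R}\to\mathbb{C}$ is locally operator-Lipschitz if it is locally bounded and measurable and for every $A>0$ there is $K_A>0$ with $\|f(X)-f(Y)\|\le K_A\|X-Y\|$ for all self-adjoint operators $X,Y$ of norm less than $A$. $f(X)$ is defined by functional calculus. A solution on $[0,t_0)$ of $dX_t=a(X_t)dt+b(X_t)(dW_t)c(X_t)$ is an adapted, norm-continuous family $(X_t)_{t\in[0,t_0)}$ of self-adjoint operators satisfying $X_t=X_0+\int_0^t a(X_\tau)d\tau+\int_0^t b(X_\tau)(dW_\tau)c(X_\tau)$ for all $t\in[0,t_0)$. At $t=0$ the time derivative is the right derivative. *)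

(* Defs.v *)
From Stdlib Require Import Reals Lra List Sorted.
From Stdlib Require Import FunctionalExtensionality ProofIrrelevance.
From Coquelicot Require Import Coquelicot.

Open Scope R_scope.

(** The inner product is linear in its first argument. *)
Record HilbertSpace := {
  hilbert_space :> CompleteNormedModule C_AbsRing;
  inner : hilbert_space -> hilbert_space -> C;
  inner_plus : forall x y z, inner (plus x y) z = Cplus (inner x z) (inner y z);
  inner_scal : forall (k : C) x y, inner (scal k x) y = Cmult k (inner x y);
  inner_conj : forall x y, inner y x = Cconj (inner x y);
  inner_norm : forall x, inner x x = RtoC (norm x ^ 2)
}.
Arguments inner {h} _ _.

(** [is_linear] includes boundedness. *)
Record BOp (H : HilbertSpace) := {
  op_fun :> H -> H;
  op_linear : is_linear op_fun
}.
Arguments op_fun {H} _ _.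
Arguments op_linear {H} _.

Lemma op_ext {H : HilbertSpace} (S T : BOp H) : (forall x, S x = T x) -> S = T.
Proof.
destruct S as [f Hf]; destruct T as [g Hg]; simpl; intros E.
assert (Efg : f = g) by (apply functional_extensionality; exact E).
subst g; f_equal; apply proof_irrelevance.
Qed.

Section Operations.
Context {H : HilbertSpace}.
Implicit Types S T : BOp H.

Lemma op_bound T : exists M, 0 < M /\ forall x, norm (T x) <= M * norm x.
Proof. exact (linear_norm _ (op_linear T)). Qed.

Lemma op_zero_linear : is_linear (fun _ : H => zero : H).
Proof. exact (@is_linear_zero C_AbsRing H H). Qed.
Definition op_zero : BOp H := Build_BOp H _ op_zero_linear.

Lemma op_one_linear : is_linear (fun x : H => x).
Proof. exact (@is_linear_id C_AbsRing H). Qed.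
Definition op_one : BOp H := Build_BOp H _ op_one_linear.

Lemma op_mult_linear S T : is_linear (fun x : H => S (T x)).
Proof. exact (@is_linear_comp C_AbsRing H H H T S (op_linear T) (op_linear S)). Qed.
Definition op_mult S T : BOp H := Build_BOp H _ (op_mult_linear S T).

Lemma op_plus_linear S T : is_linear (fun x : H => plus (S x) (T x)).
Proof.
split.
- intros x y; rewrite (linear_plus _ (op_linear S)), (linear_plus _ (op_linear T)).
  rewrite <- !plus_assoc; f_equal.
  rewrite !plus_assoc; f_equal; apply plus_comm.
- intros k x; rewrite (linear_scal _ (op_linear S)), (linear_scal _ (op_linear T)).
  symmetry; apply (@scal_distr_l C_Ring (CompleteNormedModule.ModuleSpace _ H)).
- destruct (op_bound S) as [M [HM BM]]; destruct (op_bound T) as [N [HN BN]].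
  exists (M + N); split; [lra|]; intros x.
  eapply Rle_trans; [apply (@norm_triangle C_AbsRing H)|].
  specialize (BM x); specialize (BN x); lra.
Qed.
Definition op_plus S T : BOp H := Build_BOp H _ (op_plus_linear S T).

Lemma op_scal_linear (k : C) T : is_linear (fun x : H => scal k (T x)).
Proof.
split.
- intros x y; rewrite (linear_plus _ (op_linear T)).
  exact (@scal_distr_l C_Ring (CompleteNormedModule.ModuleSpace _ H) k (T x) (T y)).
- intros l x; rewrite (linear_scal _ (op_linear T)).
  rewrite (@scal_assoc C_Ring (CompleteNormedModule.ModuleSpace _ H)), (@scal_assoc C_Ring (CompleteNormedModule.ModuleSpace _ H)); f_equal; apply Cmult_comm.
- destruct (op_bound T) as [M [HM BM]].
  pose proof (Cmod_ge_0 k) as Hk.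
  exists (Cmod k * M + 1); split.
  { pose proof (Rmult_le_pos _ _ Hk (Rlt_le _ _ HM)); lra. }
  intros x; eapply Rle_trans; [apply (@norm_scal C_AbsRing H)|].
  change (abs (K := C_AbsRing) k) with (Cmod k).
  pose proof (@norm_ge_0 C_AbsRing H x).
  pose proof (Rmult_le_compat_l _ _ _ Hk (BM x)); nra.
Qed.
Definition op_scal (k : C) T : BOp H := Build_BOp H _ (op_scal_linear k T).

Definition op_opp T : BOp H := op_scal (RtoC (-1)) T.

Fixpoint op_pow T (n : nat) : BOp H :=
  match n with O => op_one | S m => op_mult T (op_pow T m) end.

Definition op_norm T : R :=
  real (Lub_Rbar (fun r => exists x : H, norm x <= 1 /\ r = norm (T x))).

End Operations.

Infix "**" := op_mult (at level 40, left associativity).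

Section OperatorNorm.
Context {H : HilbertSpace}.
Implicit Types S T : BOp H.

Lemma op_map_zero T : T zero = zero.
Proof.
pose proof (linear_plus _ (op_linear T) zero zero) as E.
rewrite plus_zero_r in E.
apply (plus_reg_l (T zero)); now rewrite plus_zero_r.
Qed.

Lemma op_norm_set_zero T : exists x : H, norm x <= 1 /\ 0 = norm (T x).
Proof.
exists zero; rewrite op_map_zero.
pose proof (@norm_zero C_AbsRing H) as Z.
split; [|symmetry; exact Z].
eapply Rle_trans; [right; exact Z|lra].
Qed.

Lemma op_norm_is_lub T :
  is_lub_Rbar (fun r => exists x : H, norm x <= 1 /\ r = norm (T x)) (Finite (op_norm T)).
Proof.
unfold op_norm; set (P := fun r => _).
destruct (op_bound T) as [M [HM BM]].
pose proof (Lub_Rbar_correct P) as L; destruct L as [L1 L2].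
assert (U : Rbar_le (Lub_Rbar P) (Finite M)).
{ apply L2; intros r [x [Hx ->]]; simpl.
  specialize (BM x); pose proof (@norm_ge_0 C_AbsRing H x); nra. }
assert (Z : Rbar_le (Finite 0) (Lub_Rbar P)).
{ apply L1; apply op_norm_set_zero. }
destruct (Lub_Rbar P) as [l| |] eqn:El; simpl in *; try easy.
Qed.

Lemma op_norm_ge_0 T : 0 <= op_norm T.
Proof.
destruct (op_norm_is_lub T) as [L _].
apply (L 0); apply op_norm_set_zero.
Qed.

Lemma op_norm_le_bound T M :
  (forall x : H, norm x <= 1 -> norm (T x) <= M) -> op_norm T <= M.
Proof.
intros B; destruct (op_norm_is_lub T) as [_ L].
apply (L (Finite M)); intros r [x [Hx ->]]; simpl; auto.
Qed.

Lemma op_norm_unit T (x : H) : norm x <= 1 -> norm (T x) <= op_norm T.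
Proof.
intros Hx; destruct (op_norm_is_lub T) as [L _].
apply (L (norm (T x))); now exists x.
Qed.

Lemma norm_scal_real (r : R) (x : H) : 0 <= r -> norm (scal (RtoC r) x) <= r * norm x.
Proof.
intros Hr; eapply Rle_trans; [apply (@norm_scal C_AbsRing H)|].
change (abs (K := C_AbsRing) (RtoC r)) with (Cmod (RtoC r)).
rewrite Cmod_R, Rabs_pos_eq; lra.
Qed.

Lemma op_norm_apply T (x : H) : norm (T x) <= op_norm T * norm x.
Proof.
destruct (Req_dec (norm x) 0) as [Z|Z].
- rewrite Z; apply (@norm_eq_zero C_AbsRing H) in Z; subst x; rewrite op_map_zero.
  rewrite Rmult_0_r; right; exact (@norm_zero C_AbsRing H).
- pose proof (@norm_ge_0 C_AbsRing H x).
  assert (Hn : 0 < norm x) by lra.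
  assert (Hi : 0 < / norm x) by now apply Rinv_0_lt_compat.
  pose (y := scal (RtoC (/ norm x)) x : H).
  assert (Ex : x = scal (RtoC (norm x)) y).
  { unfold y; rewrite scal_assoc.
    change (mult (RtoC (norm x)) (RtoC (/ norm x)))
      with (Cmult (RtoC (norm x)) (RtoC (/ norm x))).
    rewrite <- RtoC_mult, Rinv_r by exact Z.
    symmetry; apply (@scal_one C_Ring (CompleteNormedModule.ModuleSpace _ H)). }
  assert (Ny : norm y <= 1).
  { unfold y; eapply Rle_trans; [apply norm_scal_real; lra|].
    rewrite Rinv_l; lra. }
  rewrite Ex at 1.
  rewrite (linear_scal _ (op_linear T)).
  eapply Rle_trans; [apply norm_scal_real; lra|].
  pose proof (op_norm_unit T y Ny); nra.
Qed.

Lemma op_norm_triangle S T : op_norm (op_plus S T) <= op_norm S + op_norm T.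
Proof.
apply op_norm_le_bound; intros x Hx; simpl.
eapply Rle_trans; [apply (@norm_triangle C_AbsRing H)|].
pose proof (op_norm_unit S x Hx); pose proof (op_norm_unit T x Hx); lra.
Qed.

Lemma op_norm_scal (k : C) T : op_norm (op_scal k T) <= Cmod k * op_norm T.
Proof.
apply op_norm_le_bound; intros x Hx; simpl.
eapply Rle_trans; [apply (@norm_scal C_AbsRing H)|].
apply Rmult_le_compat_l; [apply Cmod_ge_0|now apply op_norm_unit].
Qed.

Lemma op_norm_eq_zero T : op_norm T = 0 -> T = op_zero.
Proof.
intros E; apply op_ext; intros x; simpl.
apply (@norm_eq_zero C_AbsRing H); pose proof (op_norm_apply T x); pose proof (@norm_ge_0 C_AbsRing H (T x)).
rewrite E in *; lra.
Qed.

Lemma op_plus_comm S T : op_plus S T = op_plus T S.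
Proof. apply op_ext; intros x; apply plus_comm. Qed.
Lemma op_plus_assoc S T U : op_plus S (op_plus T U) = op_plus (op_plus S T) U.
Proof. apply op_ext; intros x; apply plus_assoc. Qed.
Lemma op_plus_zero_r T : op_plus T op_zero = T.
Proof. apply op_ext; intros x; apply plus_zero_r. Qed.
Lemma op_plus_opp_r T : op_plus T (op_opp T) = op_zero.
Proof.
apply op_ext; intros x; simpl.
replace (RtoC (-1)) with (opp (one : C_Ring)).
- rewrite scal_opp_one; exact (@plus_opp_r (CompleteNormedModule.AbelianGroup _ H) (T x)).
- apply injective_projections; simpl; unfold opp; simpl; lra.
Qed.

Definition BOp_AbelianMonoid_mixin :=
  AbelianMonoid.Mixin (BOp H) op_plus op_zero op_plus_comm op_plus_assoc op_plus_zero_r.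
Canonical BOp_AbelianMonoid :=
  AbelianMonoid.Pack (BOp H) BOp_AbelianMonoid_mixin (BOp H).
Definition BOp_AbelianGroup_mixin :=
  AbelianGroup.Mixin BOp_AbelianMonoid op_opp op_plus_opp_r.
Canonical BOp_AbelianGroup := AbelianGroup.Pack (BOp H)
  (AbelianGroup.Class _ BOp_AbelianMonoid_mixin BOp_AbelianGroup_mixin) (BOp H).

Lemma op_norm_opp T : op_norm (op_opp T) <= op_norm T.
Proof.
eapply Rle_trans; [apply op_norm_scal|].
rewrite Cmod_R, Rabs_left; lra.
Qed.

Definition op_ball (T : BOp H) (e : R) (S : BOp H) : Prop := op_norm (minus S T) < e.

Lemma op_ball_center T (e : posreal) : op_ball T e T.
Proof.
unfold op_ball; rewrite minus_eq_zero.
apply Rle_lt_trans with 0; [|apply cond_pos].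
apply op_norm_le_bound; intros x _.
right; exact (@norm_zero C_AbsRing H).
Qed.

Lemma op_ball_sym S T (e : R) : op_ball S e T -> op_ball T e S.
Proof.
unfold op_ball; intros B; rewrite <- (opp_minus T S).
eapply Rle_lt_trans; [apply op_norm_opp|exact B].
Qed.

Lemma op_ball_triangle S T U (e1 e2 : R) :
  op_ball S e1 T -> op_ball T e2 U -> op_ball S (e1 + e2) U.
Proof.
unfold op_ball; intros B1 B2; rewrite (minus_trans T U S).
eapply Rle_lt_trans; [apply op_norm_triangle|lra].
Qed.

Definition BOp_UniformSpace_mixin := UniformSpace.Mixin (BOp H) op_zero op_ball
  op_ball_center op_ball_sym op_ball_triangle.
Canonical BOp_UniformSpace :=
  UniformSpace.Pack (BOp H) BOp_UniformSpace_mixin (BOp H).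

Definition op_rscal (r : R) (T : BOp H) : BOp H := op_scal (RtoC r) T.

Lemma op_rscal_assoc (r s : R) T : op_rscal r (op_rscal s T) = op_rscal (r * s) T.
Proof.
apply op_ext; intros x; simpl; rewrite RtoC_mult; apply (@scal_assoc C_Ring (CompleteNormedModule.ModuleSpace _ H)).
Qed.
Lemma op_rscal_one T : op_rscal 1 T = T.
Proof. apply op_ext; intros x; apply (@scal_one C_Ring (CompleteNormedModule.ModuleSpace _ H)). Qed.
Lemma op_rscal_distr_l (r : R) S T :
  op_rscal r (op_plus S T) = op_plus (op_rscal r S) (op_rscal r T).
Proof. apply op_ext; intros x; apply (@scal_distr_l C_Ring (CompleteNormedModule.ModuleSpace _ H)). Qed.
Lemma op_rscal_distr_r (r s : R) T :
  op_rscal (r + s) T = op_plus (op_rscal r T) (op_rscal s T).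
Proof.
apply op_ext; intros x; simpl; rewrite RtoC_plus; apply (@scal_distr_r C_Ring (CompleteNormedModule.ModuleSpace _ H)).
Qed.

Definition BOp_ModuleSpace_mixin :=
  ModuleSpace.Mixin R_Ring BOp_AbelianGroup op_rscal
    op_rscal_assoc op_rscal_one op_rscal_distr_l op_rscal_distr_r.
Definition BOp_ModuleSpace_class :=
  ModuleSpace.Class R_Ring (BOp H) (AbelianGroup.class BOp_AbelianGroup)
    BOp_ModuleSpace_mixin.
Canonical BOp_ModuleSpace :=
  ModuleSpace.Pack R_Ring (BOp H) BOp_ModuleSpace_class (BOp H).

Definition BOp_NormedModuleAux_class :=
  NormedModuleAux.Class R_AbsRing (BOp H) BOp_ModuleSpace_class BOp_UniformSpace_mixin.
Canonical BOp_NormedModuleAux :=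
  NormedModuleAux.Pack R_AbsRing (BOp H) BOp_NormedModuleAux_class (BOp H).

Lemma op_norm_rscal (r : R) T : op_norm (op_rscal r T) <= Rabs r * op_norm T.
Proof. rewrite <- Cmod_R; apply op_norm_scal. Qed.
Lemma op_norm_compat1 S T (e : R) : op_norm (minus T S) < e -> ball S e T.
Proof. exact (fun h => h). Qed.
Lemma op_norm_compat2 S T (e : posreal) : ball S e T -> op_norm (minus T S) < 1 * e.
Proof. rewrite Rmult_1_l; exact (fun h => h). Qed.

Definition BOp_NormedModule_mixin :=
  NormedModule.Mixin R_AbsRing BOp_NormedModuleAux op_norm 1
    op_norm_triangle op_norm_rscal op_norm_compat1 op_norm_compat2 op_norm_eq_zero.
Canonical BOp_NormedModule := NormedModule.Pack R_AbsRing (BOp H)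
  (NormedModule.Class R_AbsRing (BOp H) BOp_NormedModuleAux_class BOp_NormedModule_mixin)
  (BOp H).

End OperatorNorm.

Section VonNeumann.
Context {H : HilbertSpace}.

Definition is_adjoint (S T : BOp H) : Prop := forall x y, inner (S x) y = inner x (T y).

Definition self_adjoint (T : BOp H) : Prop := is_adjoint T T.

Definition op_positive (T : BOp H) : Prop :=
  forall x, Im (inner (T x) x) = 0 /\ 0 <= Re (inner (T x) x).

Definition op_le (S T : BOp H) : Prop := op_positive (minus T S).

Definition commutant (M : BOp H -> Prop) (T : BOp H) : Prop :=
  forall S, M S -> S ** T = T ** S.

(** Self-adjoint sets that equal their bicommutant; they are automatically
    unital subalgebras, and weakly closed. *)
Definition von_neumann_algebra (M : BOp H -> Prop) : Prop :=
  (forall T, M T -> exists S, M S /\ is_adjoint T S) /\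
  (forall T, M T <-> commutant (commutant M) T).

Definition is_sa_lub (M D : BOp H -> Prop) (T : BOp H) : Prop :=
  (M T /\ self_adjoint T) /\
  (forall S, D S -> op_le S T) /\
  (forall U, M U -> self_adjoint U -> (forall S, D S -> op_le S U) -> op_le T U).

(** Order continuity: suprema of upward directed families of self-adjoint
    elements (increasing nets) are preserved. *)
Definition normal_on (M : BOp H -> Prop) (E : BOp H -> C) : Prop :=
  forall (D : BOp H -> Prop) (T : BOp H),
    (exists S, D S) ->
    (forall S, D S -> M S /\ self_adjoint S) ->
    (forall S1 S2, D S1 -> D S2 -> exists S, D S /\ op_le S1 S /\ op_le S2 S) ->
    is_sa_lub M D T ->
    is_lub (fun r => exists S, D S /\ r = Re (E S)) (Re (E T)).

(** The values of [E] outside [M] are irrelevant. *)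
Record W_probability_space (M : BOp H -> Prop) (E : BOp H -> C) : Prop := {
  wps_algebra : von_neumann_algebra M;
  wps_plus : forall S T, M S -> M T -> E (plus S T) = Cplus (E S) (E T);
  wps_scal : forall k T, M T -> E (op_scal k T) = Cmult k (E T);
  wps_one : E op_one = RtoC 1;
  wps_positive : forall T, M T -> op_positive T -> Im (E T) = 0 /\ 0 <= Re (E T);
  wps_faithful : forall T, M T -> op_positive T -> E T = RtoC 0 -> T = op_zero;
  wps_tracial : forall S T, M S -> M T -> E (S ** T) = E (T ** S);
  wps_normal : normal_on M E
}.

Definition op_prod (l : list (BOp H)) : BOp H := fold_right op_mult op_one l.

(** [A] is meant to be a family of unital subalgebras; [Sorted] with the
    relation "different indices" says that consecutive indices differ. *)
Definition free_family (E : BOp H -> C) {I : Type} (A : I -> BOp H -> Prop) : Prop :=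
  forall w : list (I * BOp H),
    w <> nil ->
    Sorted (fun p q => fst p <> fst q) w ->
    List.Forall (fun p => A (fst p) (snd p) /\ E (snd p) = RtoC 0) w ->
    E (op_prod (List.map snd w)) = RtoC 0.

(** The unital algebra generated by [T]; a *-algebra when [T] is self-adjoint. *)
Inductive generated_algebra (T : BOp H) : BOp H -> Prop :=
| gen_self : generated_algebra T T
| gen_one : generated_algebra T op_one
| gen_plus S U : generated_algebra T S -> generated_algebra T U ->
    generated_algebra T (plus S U)
| gen_scal k S : generated_algebra T S -> generated_algebra T (op_scal k S)
| gen_mult S U : generated_algebra T S -> generated_algebra T U ->
    generated_algebra T (S ** U).

Definition free_from (E : BOp H -> C) (T : BOp H) (B : BOp H -> Prop) : Prop :=
  free_family E (fun i : bool => if i then generated_algebra T else B).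

Definition semicircle_density (v x : R) : R := sqrt (4 * v - x ^ 2) / (2 * PI * v).

(** The distribution of a bounded self-adjoint element is the compactly supported
    measure with the same moments. *)
Definition semicircular (E : BOp H -> C) (T : BOp H) (v : R) : Prop :=
  forall n : nat,
    E (op_pow T n) =
    RtoC (RInt (fun x => x ^ n * semicircle_density v x) (- (2 * sqrt v)) (2 * sqrt v)).

Record filtration (M : BOp H -> Prop) (A : R -> BOp H -> Prop) : Prop := {
  filt_algebra : forall t, 0 <= t -> von_neumann_algebra (A t);
  filt_sub : forall t T, 0 <= t -> A t T -> M T;
  filt_mono : forall s t T, 0 <= s <= t -> A s T -> A t T
}.

Record free_brownian_motion (E : BOp H -> C) (A : R -> BOp H -> Prop)
    (W : R -> BOp H) : Prop := {
  fbm_zero : W 0 = zero;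
  fbm_self_adjoint : forall t, 0 <= t -> self_adjoint (W t);
  fbm_adapted : forall t, 0 <= t -> A t (W t);
  fbm_free : forall s t, 0 <= s < t -> free_from E (minus (W t) (W s)) (A s);
  fbm_semicircular : forall s t, 0 <= s < t ->
    semicircular E (minus (W t) (W s)) (t - s)
}.

(** Since [tau i <= t (pred i)], the bound on [t i - tau i] also bounds the mesh. *)
Definition is_free_integral (W u v : R -> BOp H) (p q : R) (J : BOp H) : Prop :=
  forall eps, 0 < eps -> exists delta, 0 < delta /\
    forall (n : nat) (t tau : nat -> R),
      t 0%nat = p -> t n = q ->
      (forall i, (1 <= i <= n)%nat ->
         t (pred i) <= t i /\ p <= tau i <= t (pred i) /\ t i - tau i < delta) ->
      op_norm (minus
        (sum_n_m (fun i => u (tau i) ** minus (W (t i)) (W (t (pred i))) ** v (tau i)) 1 n)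
        J) < eps.

End VonNeumann.

Inductive Borel_set : (R -> Prop) -> Prop :=
| Borel_open U : open U -> Borel_set U
| Borel_compl B : Borel_set B -> Borel_set (fun x => ~ B x)
| Borel_union (B : nat -> R -> Prop) :
    (forall n, Borel_set (B n)) -> Borel_set (fun x => exists n, B n x).

Definition Borel_fun (f : R -> C) : Prop :=
  forall U : C -> Prop, open U -> Borel_set (fun x => U (f x)).

Definition locally_bounded (f : R -> C) : Prop :=
  forall A : R, exists M, forall x, Rabs x <= A -> Cmod (f x) <= M.

Definition calculus_fun (f : R -> C) : Prop := locally_bounded f /\ Borel_fun f.

(** The Borel functional calculus of [T]: the unique *-homomorphism on locally
    bounded Borel functions that sends the identity function to [T] and turns
    locally bounded pointwise convergence into strong convergence. *)
Record Borel_calculus {H : HilbertSpace} (T : BOp H) (Phi : (R -> C) -> BOp H) : Prop := {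
  bc_id : Phi RtoC = T;
  bc_one : Phi (fun _ => RtoC 1) = op_one;
  bc_plus : forall f g, calculus_fun f -> calculus_fun g ->
    Phi (fun x => Cplus (f x) (g x)) = plus (Phi f) (Phi g);
  bc_scal : forall k f, calculus_fun f ->
    Phi (fun x => Cmult k (f x)) = op_scal k (Phi f);
  bc_mult : forall f g, calculus_fun f -> calculus_fun g ->
    Phi (fun x => Cmult (f x) (g x)) = Phi f ** Phi g;
  bc_conj : forall f, calculus_fun f ->
    is_adjoint (Phi f) (Phi (fun x => Cconj (f x)));
  bc_lim : forall (fn : nat -> R -> C) (f : R -> C),
    (forall n, calculus_fun (fn n)) -> calculus_fun f ->
    (forall A : R, exists M, forall n x, Rabs x <= A -> Cmod (fn n x) <= M) ->
    (forall x, filterlim (fun n => fn n x) eventually (locally (f x))) ->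
    forall xi : H, filterlim (fun n => Phi (fn n) xi) eventually (locally (Phi f xi))
}.

Definition is_fun_calc {H : HilbertSpace} (f : R -> C) (T S : BOp H) : Prop :=
  exists Phi, Borel_calculus T Phi /\ S = Phi f.

Definition locally_operator_Lipschitz (f : R -> C) : Prop :=
  locally_bounded f /\ Borel_fun f /\
  forall A, 0 < A -> exists K, 0 < K /\
    forall (H : HilbertSpace) (X Y fX fY : BOp H),
      self_adjoint X -> self_adjoint Y -> op_norm X < A -> op_norm Y < A ->
      is_fun_calc f X fX -> is_fun_calc f Y fY ->
      op_norm (minus fX fY) <= K * op_norm (minus X Y).

Definition free_SDE_solution {H : HilbertSpace} (A : R -> BOp H -> Prop)
    (W : R -> BOp H) (a b c : R -> C) (t0 : R) (X : R -> BOp H) : Prop :=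
  (forall t, 0 <= t < t0 -> A t (X t) /\ self_adjoint (X t)) /\
  continuous_on (fun t => 0 <= t < t0) X /\
  exists aX bX cX : R -> BOp H,
    (forall t, 0 <= t < t0 ->
       is_fun_calc a (X t) (aX t) /\ is_fun_calc b (X t) (bX t) /\
       is_fun_calc c (X t) (cX t)) /\
    forall t, 0 <= t < t0 -> exists I J : BOp H,
      is_RInt aX 0 t I /\ is_free_integral W bX cX 0 t J /\
      X t = plus (X 0) (plus I J).

Definition is_resolvent {H : HilbertSpace} (X : BOp H) (z : C) (G : BOp H) : Prop :=
  G ** minus X (op_scal z op_one) = op_one /\
  minus X (op_scal z op_one) ** G = op_one.

(** The derivative of [g] at [t] relative to the domain [D]: the usual derivative
    at interior points, a one-sided derivative at end points in [D]. *)
Definition is_derive_within (D : R -> Prop) (g : R -> C) (t : R) (l : C) : Prop :=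
  filterdiff (U := R_NormedModule) (V := C_R_NormedModule) g (within D (locally t))
    (fun h : R => scal (V := C_R_NormedModule) h l).

(* Main.v *)
Require Import Defs.
From Stdlib Require Import List Reals Lra Lia FunctionalExtensionality IndefiniteDescription.
From Stdlib Require Import Ncring Ncring_tac.
From Coquelicot Require Import Coquelicot.

Open Scope R_scope.

(** Write [D = X r - X s], which is the sum of the drift increment and of the
    increment [J] of the free stochastic integral. Iterating the resolvent identity,
    [G r = G - G D G + G D G D G - G D G D G D (G r)] with [G = G s].
    Approximating [J] by sums over partitions of [[s, r]] and using freeness of
    the increments of [W] from the past, [E (Y J) = 0], and [E (Y1 J Y2 J)] is the
    limit of the sums of [dt * E (c Y1 b) * E (c Y2 b)]; this gives the drift term
    and the product term. In particular [E (D D) = O(r - s)], so that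
    the cubic term is at most a constant times [E (D D)] times the operator
    norm of [G D G], that is [o(r - s)] by norm continuity of [X] alone: no
    Burkholder-Gundy estimate of [J] in operator norm is needed.
    All estimates are uniform for [s <= t <= r] near [t], which yields both one-sided
    derivatives. The values [a (X t)] are adapted because a locally operator-Lipschitz
    function is continuous, hence a limit of Bernstein polynomials. *)

(** * The algebra of bounded operators *)

(** The resolvent [G r] depends on the very increments that are averaged, so freeness says nothing
    about the cubic term; only norms and positivity of the trace are available there. A trace form
    of Cauchy-Schwarz keeps two of the three factors [D] inside [E (D ** D)] and charges only the
    third in operator norm. The expansion is made at [s], since [G s] lies in the past of the
    increment, while the limit is written with values at [t]; norm continuity bridges the two. The
    product of two expectations comes from the formula [E (Y1 ** T ** Y2 ** T) = v * (E Y1 * E Y2)]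
    for a centred [T] of variance [v] that is free from [Y1] and [Y2]. The functional calculus is
    given only through a witness [Phi]: commutation with the commutant yields adaptedness of its
    values, and the Lipschitz inequality at equal arguments yields their uniqueness. *)

Section OperatorAlgebra.
Context {H : HilbertSpace}.
Implicit Types S T U : BOp H.

Lemma op_mult_assoc S T U : S ** (T ** U) = S ** T ** U.
Proof. now apply op_ext. Qed.

Lemma op_mult_one_l T : op_one ** T = T.
Proof. now apply op_ext. Qed.

Lemma op_mult_one_r T : T ** op_one = T.
Proof. now apply op_ext. Qed.

Lemma op_mult_plus_l S T U : plus S T ** U = plus (S ** U) (T ** U).
Proof. now apply op_ext. Qed.

Lemma op_mult_plus_r S T U : U ** plus S T = plus (U ** S) (U ** T).
Proof. apply op_ext; intros x; simpl. exact (linear_plus _ (op_linear U) (S x) (T x)). Qed.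

Lemma op_scal_mult_l k S T : op_scal k S ** T = op_scal k (S ** T).
Proof. now apply op_ext. Qed.

Lemma op_scal_mult_r k S T : S ** op_scal k T = op_scal k (S ** T).
Proof. apply op_ext; intros x; simpl. exact (linear_scal _ (op_linear S) k (T x)). Qed.

(** Makes [non_commutative_ring] available for operator identities. Terms [op_scal k T] are atoms
    for it, so scalars must be moved out by hand. *)
#[global] Instance BOp_ring_ops : @Ring_ops (BOp H) op_zero op_one plus op_mult minus opp eq := {}.
#[global] Instance BOp_ring : @Ncring.Ring (BOp H) _ _ _ _ _ _ _ BOp_ring_ops.
Proof.
split.
- apply eq_equivalence.
- intros S T -> U V ->; reflexivity.
- intros S T -> U V ->; reflexivity.
- intros S T -> U V ->; reflexivity.
- intros S T ->; reflexivity.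
- exact plus_zero_l.
- exact plus_comm.
- exact plus_assoc.
- exact op_mult_one_l.
- exact op_mult_one_r.
- exact op_mult_assoc.
- exact op_mult_plus_l.
- exact op_mult_plus_r.
- intros S T; reflexivity.
- exact plus_opp_r.
Qed.

Lemma minus_eq_zero_inv S T : minus S T = op_zero -> S = T.
Proof.
intros E; transitivity (plus (minus S T) T).
- non_commutative_ring.
- rewrite E; non_commutative_ring.
Qed.

Lemma op_norm_minus_eq S T : op_norm (minus S T) <= 0 -> S = T.
Proof.
intros N; apply minus_eq_zero_inv, op_norm_eq_zero.
pose proof (op_norm_ge_0 (minus S T)); lra.
Qed.

Lemma op_norm_minus_sym S T : op_norm (minus S T) = op_norm (minus T S).
Proof.
apply Rle_antisym.
- rewrite <- (opp_minus T S); apply op_norm_opp.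
- rewrite <- (opp_minus S T); apply op_norm_opp.
Qed.

Lemma op_norm_minus S T : op_norm (minus S T) <= op_norm S + op_norm T.
Proof.
eapply Rle_trans; [apply op_norm_triangle|].
pose proof (op_norm_opp T : op_norm (opp T) <= _); lra.
Qed.

Lemma op_norm_zero : op_norm (op_zero : BOp H) <= 0.
Proof.
apply op_norm_le_bound; intros x _; right; exact (@norm_zero C_AbsRing H).
Qed.

Lemma op_norm_one : op_norm (op_one : BOp H) <= 1.
Proof. now apply op_norm_le_bound. Qed.

Lemma op_norm_mult S T p q :
  op_norm S <= p -> op_norm T <= q -> op_norm (S ** T) <= p * q.
Proof.
intros HS HT; pose proof (op_norm_ge_0 S); pose proof (op_norm_ge_0 T).
apply op_norm_le_bound; intros x Hx.
eapply Rle_trans; [apply (op_norm_apply S)|].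
pose proof (op_norm_unit T x Hx); pose proof (@norm_ge_0 C_AbsRing H (T x)); nra.
Qed.

(** Telescoping [S (T - T') + (S - S') T']. The bound has the shape of a product rule, so it can be
    nested along longer products. *)
Lemma op_norm_mult_minus S S' T T' p q d e :
  op_norm S <= p -> op_norm T' <= q ->
  op_norm (minus S S') <= d -> op_norm (minus T T') <= e ->
  op_norm (minus (S ** T) (S' ** T')) <= p * e + d * q.
Proof.
intros HS HT HSS HTT.
replace (minus (S ** T) (S' ** T'))
  with (plus (S ** minus T T') (minus S S' ** T')) by non_commutative_ring.
eapply Rle_trans; [apply op_norm_triangle|].
apply Rplus_le_compat; now apply op_norm_mult.
Qed.

Lemma op_norm_near S T p e :
  op_norm S <= p -> op_norm (minus T S) <= e -> op_norm T <= p + e.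
Proof.
intros HS HT; replace T with (plus S (minus T S)) by non_commutative_ring.
eapply Rle_trans; [apply op_norm_triangle|lra].
Qed.

(** * Von Neumann algebras *)

Section Algebra.
Context (N : BOp H -> Prop) (HN : von_neumann_algebra N).

(** As for the other closure properties, the bicommutant identity reduces membership to commutation
    with an arbitrary [U] in the commutant. *)
Lemma vn_one : N op_one.
Proof. apply HN; intros S _; now rewrite op_mult_one_l, op_mult_one_r. Qed.

Lemma vn_plus S T : N S -> N T -> N (plus S T).
Proof.
intros HS HT; apply HN; intros U HU.
apply HN in HS, HT; rewrite op_mult_plus_l, op_mult_plus_r.
now rewrite (HS U HU), (HT U HU).
Qed.

Lemma vn_mult S T : N S -> N T -> N (S ** T).
Proof.
intros HS HT; apply HN; intros U HU; apply HN in HS, HT.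
now rewrite op_mult_assoc, (HS U HU), <- op_mult_assoc, (HT U HU), op_mult_assoc.
Qed.

Lemma vn_scal k T : N T -> N (op_scal k T).
Proof.
intros HT; apply HN; intros U HU; apply HN in HT.
now rewrite op_scal_mult_l, op_scal_mult_r, (HT U HU).
Qed.

Lemma vn_opp T : N T -> N (opp T).
Proof. apply vn_scal. Qed.

Lemma vn_minus S T : N S -> N T -> N (minus S T).
Proof. intros HS HT; apply vn_plus; [exact HS|now apply vn_opp]. Qed.

Lemma vn_zero : N op_zero.
Proof.
replace (op_zero : BOp H) with (minus op_one op_one : BOp H) by non_commutative_ring.
apply vn_minus; apply vn_one.
Qed.

Lemma vn_norm_closed T :
  (forall e, 0 < e -> exists S, N S /\ op_norm (minus S T) < e) -> N T.
Proof.
intros L; apply HN; intros U HU; symmetry; apply op_norm_minus_eq, le_epsilon; intros e He.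
pose proof (op_norm_ge_0 U) as HU0.
(* Replacing [T] by [S] changes the commutator with [U] by at most
   [2 * op_norm U * op_norm (minus S T)]; the [+ 1] keeps the denominator positive. *)
assert (He' : 0 < e / (2 * op_norm U + 1)) by (apply Rdiv_lt_0_compat; lra).
destruct (L _ He') as [S [HS B]]; apply HN in HS; specialize (HS U HU).
replace (minus (T ** U) (U ** T))
  with (plus (minus (U ** minus S T) (minus S T ** U)) (minus (S ** U) (U ** S)))
  by non_commutative_ring.
rewrite HS, minus_eq_zero, plus_zero_r.
eapply Rle_trans; [apply op_norm_minus|].
pose proof (op_norm_mult U (minus S T) _ _ (Rle_refl _) (Rlt_le _ _ B)).
pose proof (op_norm_mult (minus S T) U _ _ (Rlt_le _ _ B) (Rle_refl _)).
apply Rle_trans with (e / (2 * op_norm U + 1) * (2 * op_norm U + 1)); [nra|].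
right; field; lra.
Qed.

Lemma vn_resolvent X z G : N X -> is_resolvent X z G -> N G.
Proof.
intros HX [GL GR]; apply HN; intros U HU; apply HN in HX; specialize (HX U HU).
set (Y := minus X (op_scal z op_one)) in *.
assert (C : U ** Y = Y ** U).
{ unfold Y, minus; rewrite op_mult_plus_l, op_mult_plus_r, HX; f_equal.
  change opp with (@op_opp H); unfold op_opp.
  now rewrite !op_scal_mult_l, !op_scal_mult_r, op_mult_one_l, op_mult_one_r. }
(* An inverse commutes with whatever [Y] commutes with: [U G = G Y U G = G U Y G = G U]. *)
transitivity (G ** Y ** U ** G).
- now rewrite GL, op_mult_one_l.
- now rewrite <- (op_mult_assoc G Y U), <- C, op_mult_assoc, <- op_mult_assoc, GR, op_mult_one_r.
Qed.

End Algebra.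
End OperatorAlgebra.
(** * Continuous functional calculus *)

(** The trace on scalars of the operator condition. It is stable under sums and products and implies
    [calculus_fun], so polynomials can be built within this class. *)
Definition locally_Lipschitz (f : R -> C) : Prop :=
  forall A, exists K, 0 <= K /\ forall x y, Rabs x <= A -> Rabs y <= A ->
    Cmod (f x - f y) <= K * Rabs (x - y).

Lemma locally_Lipschitz_bounded f : locally_Lipschitz f -> locally_bounded f.
Proof.
intros Lf A; destruct (Lf (Rabs A)) as [K [HK L]].
exists (Cmod (f 0) + K * Rabs A); intros x Hx.
assert (A0 : Rabs x <= Rabs A) by (eapply Rle_trans; [exact Hx|apply Rle_abs]).
assert (B := L x 0 A0); rewrite Rabs_R0, Rminus_0_r in B.
specialize (B (Rabs_pos A)).
replace (f x) with (f 0 + (f x - f 0))%C by ring.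
eapply Rle_trans; [apply Cmod_triangle|].
apply Rplus_le_compat_l; eapply Rle_trans; [exact B|].
now apply Rmult_le_compat_l.
Qed.

Lemma locally_Lipschitz_Borel f : locally_Lipschitz f -> Borel_fun f.
Proof.
intros Lf U HU; apply Borel_open; intros x Hx.
destruct (HU (f x) Hx) as [e He].
destruct (Lf (Rabs x + 1)) as [K [HK L]].
assert (Hd : 0 < Rmin 1 (e / (K + 1))).
{ apply Rmin_pos; [lra|apply Rdiv_lt_0_compat; [apply cond_pos|lra]]. }
exists (mkposreal _ Hd); intros y Hy; apply He.
change (Rabs (y - x) < Rmin 1 (e / (K + 1))) in Hy.
apply (@norm_compat1 _ C_NormedModule); change (Cmod (f y - f x) < e).
pose proof (Rmin_l 1 (e / (K + 1))); pose proof (Rmin_r 1 (e / (K + 1))).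
assert (Rabs y <= Rabs x + 1).
{ replace y with (x + (y - x)) by ring; eapply Rle_trans; [apply Rabs_triang|lra]. }
eapply Rle_lt_trans; [apply L; lra|].
apply Rle_lt_trans with ((K + 1) * Rabs (y - x)).
- pose proof (Rabs_pos (y - x)); nra.
- replace (pos e) with ((K + 1) * (e / (K + 1))) by (field; lra).
  apply Rmult_lt_compat_l; lra.
Qed.

Lemma locally_Lipschitz_calculus f : locally_Lipschitz f -> calculus_fun f.
Proof.
intros Lf; split; [now apply locally_Lipschitz_bounded|now apply locally_Lipschitz_Borel].
Qed.

Lemma locally_Lipschitz_const k : locally_Lipschitz (fun _ => k).
Proof.
intros A; exists 0; split; [lra|]; intros x y _ _.
replace (k - k)%C with (RtoC 0) by ring; rewrite Cmod_0; lra.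
Qed.

Lemma locally_Lipschitz_id : locally_Lipschitz RtoC.
Proof.
intros A; exists 1; split; [lra|]; intros x y _ _.
rewrite <- RtoC_minus, Cmod_R; lra.
Qed.

Lemma locally_Lipschitz_plus f g :
  locally_Lipschitz f -> locally_Lipschitz g -> locally_Lipschitz (fun x => f x + g x)%C.
Proof.
intros Lf Lg A; destruct (Lf A) as [K [HK LK]]; destruct (Lg A) as [L [HL LL]].
exists (K + L); split; [lra|]; intros x y Hx Hy.
replace (f x + g x - (f y + g y))%C with ((f x - f y) + (g x - g y))%C by ring.
eapply Rle_trans; [apply Cmod_triangle|].
rewrite Rmult_plus_distr_r; apply Rplus_le_compat; auto.
Qed.

Lemma locally_Lipschitz_mult f g :
  locally_Lipschitz f -> locally_Lipschitz g -> locally_Lipschitz (fun x => f x * g x)%C.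
Proof.
intros Lf Lg A; destruct (Lf A) as [K [HK LK]]; destruct (Lg A) as [L [HL LL]].
destruct (locally_Lipschitz_bounded f Lf A) as [P HP].
destruct (locally_Lipschitz_bounded g Lg A) as [Q HQ].
exists (Rabs P * L + Rabs Q * K); split.
{ pose proof (Rabs_pos P); pose proof (Rabs_pos Q); nra. }
intros x y Hx Hy.
replace (f x * g x - f y * g y)%C with (f x * (g x - g y) + (f x - f y) * g y)%C by ring.
eapply Rle_trans; [apply Cmod_triangle|].
rewrite !Cmod_mult, Rmult_plus_distr_r; apply Rplus_le_compat.
- rewrite Rmult_assoc; apply Rmult_le_compat; auto using Cmod_ge_0.
  eapply Rle_trans; [now apply HP|apply Rle_abs].
- replace (Rabs Q * K * Rabs (x - y)) with ((K * Rabs (x - y)) * Rabs Q) by ring.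
  apply Rmult_le_compat; auto using Cmod_ge_0.
  eapply Rle_trans; [now apply HQ|apply Rle_abs].
Qed.

(** [bernstein phi y n k] is the expectation of [phi (k + B)] for a binomial
    variable [B] with parameters [n] and [y]. *)
Fixpoint bernstein (phi : nat -> C) (y : R) (n k : nat) : C :=
  match n with
  | O => phi k
  | S m => (RtoC (1 - y) * bernstein phi y m k + RtoC y * bernstein phi y m (S k))%C
  end.

(** The mean of a quadratic under a binomial law is squared bias plus variance. The induction
    conditions on one trial, which shifts [k] by 0 or 1. *)
Lemma bernstein_error (phi : nat -> C) (v : C) (y p q c : R) (n : nat) :
  0 <= y <= 1 -> forall k,
  (forall j, (k <= j <= k + n)%nat -> Cmod (phi j - v) <= p + q * (INR j - c) ^ 2) ->
  Cmod (bernstein phi y n k - v)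
    <= p + q * ((INR k + INR n * y - c) ^ 2 + INR n * y * (1 - y)).
Proof.
intros Hy; induction n as [|n IH]; intros k B.
- eapply Rle_trans; [apply B; lia|]; simpl; right; ring.
- simpl bernstein.
  replace (RtoC (1 - y) * bernstein phi y n k + RtoC y * bernstein phi y n (S k) - v)%C
    with (RtoC (1 - y) * (bernstein phi y n k - v)
          + RtoC y * (bernstein phi y n (S k) - v))%C
    by (rewrite RtoC_minus; ring).
  eapply Rle_trans; [apply Cmod_triangle|].
  rewrite !Cmod_mult, !Cmod_R, !Rabs_pos_eq by lra.
  assert (B1 := IH k ltac:(intros; apply B; lia)).
  assert (B2 := IH (S k) ltac:(intros; apply B; lia)).
  apply (Rmult_le_compat_l (1 - y)) in B1; [|lra].
  apply (Rmult_le_compat_l y) in B2; [|lra].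
  eapply Rle_trans; [apply Rplus_le_compat; [exact B1|exact B2]|].
  rewrite !S_INR; right; ring.
Qed.

Lemma bernstein_approximation f N :
  locally_Lipschitz f -> (0 < N)%nat -> exists m, (0 < m)%nat /\
  forall x, Rabs x <= INR N ->
    Cmod (bernstein (fun j => f (- INR N + 2 * INR N * INR j / INR (m * m)))
            ((x + INR N) / (2 * INR N)) (m * m) 0 - f x) <= / INR N.
Proof.
intros Lf HN; destruct (Lf (INR N)) as [K [HK L]].
assert (HN' : 0 < INR N) by now apply (lt_INR 0).
(* With degree [m * m] the deviation [d] from the binomial mean is of order [m], and
   [m |d| <= m ^ 2 + d ^ 2] gives the quadratic majorant. The total error is at most
   [4 * N * K / m], which is below [/ N] for this [m]. *)
destruct (INR_unbounded (4 * INR N * K * INR N)) as [m Hm].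
assert (HP : 0 <= 4 * INR N * K * INR N) by (repeat apply Rmult_le_pos; lra).
exists m; assert (Hm0 : 0 < INR m) by lra.
split; [now apply INR_lt|]; intros x Hx.
set (y := (x + INR N) / (2 * INR N)).
assert (Hx' := Hx); apply Rabs_le_between in Hx'.
assert (Hy : 0 <= y <= 1).
{ unfold y; split; [apply Rdiv_le_0_compat; lra|].
  apply Rmult_le_reg_r with (2 * INR N); [lra|]; field_simplify; lra. }
assert (Ex : x = - INR N + 2 * INR N * y) by (unfold y; field; lra).
rewrite mult_INR.
eapply Rle_trans.
- apply (bernstein_error _ _ _ (2 * INR N * K / INR m)
    (2 * INR N * K / (INR m * INR m * INR m)) (INR m * INR m * y)); [exact Hy|].
  intros j Hj; assert (Hj' : INR j <= INR m * INR m) by (rewrite <- mult_INR; apply le_INR; lia).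
  pose proof (pos_INR j).
  eapply Rle_trans.
  + apply L; [|exact Hx]; apply Rabs_le.
    assert (0 <= INR j / (INR m * INR m) <= 1).
    { split; [apply Rdiv_le_0_compat; nra|].
      apply Rmult_le_reg_r with (INR m * INR m); [nra|]; field_simplify; lra. }
    replace (2 * INR N * INR j / (INR m * INR m))
      with (2 * INR N * (INR j / (INR m * INR m))) by (field; lra).
    nra.
  + set (d := INR j - INR m * INR m * y).
    replace (- INR N + 2 * INR N * INR j / (INR m * INR m) - x)
      with (2 * INR N / (INR m * INR m) * d) by (unfold d; rewrite Ex; field; lra).
    rewrite Rabs_mult, (Rabs_pos_eq (2 * INR N / _)) by (apply Rdiv_le_0_compat; nra).
    apply Rle_trans with (2 * INR N * K / (INR m * INR m * INR m) * (INR m * Rabs d)).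
    { right; field; lra. }
    replace (2 * INR N * K / INR m + 2 * INR N * K / (INR m * INR m * INR m) * d ^ 2)
      with (2 * INR N * K / (INR m * INR m * INR m) * (INR m * INR m + d ^ 2))
      by (field; lra).
    apply Rmult_le_compat_l.
    * apply Rdiv_le_0_compat; [apply Rmult_le_pos; lra|].
      repeat apply Rmult_lt_0_compat; lra.
    * rewrite <- (pow2_abs d); pose proof (Rabs_pos d).
      pose proof (pow2_ge_0 (INR m - Rabs d)); nra.
- rewrite mult_INR; simpl (INR 0).
  replace (0 + INR m * INR m * y - INR m * INR m * y) with 0 by ring.
  apply Rle_trans with (2 * INR N * K / INR m + 2 * INR N * K / (INR m * INR m * INR m) * (INR m * INR m)).
  + apply Rplus_le_compat_l, Rmult_le_compat_l; [|nra].
    apply Rdiv_le_0_compat; [apply Rmult_le_pos; lra|].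
    repeat apply Rmult_lt_0_compat; lra.
  + apply Rmult_le_reg_r with (INR m * INR N); [nra|].
    field_simplify; lra.
Qed.

(** [bc_lim] asks for one bound valid for every index, whereas the approximants are controlled on a
    given interval only from some index on; the finitely many others enter through a maximum. *)
Lemma uniform_bound (u : nat -> R -> C) (D : R -> Prop) (N : nat) (M : R) :
  (forall n, exists B, forall x, D x -> Cmod (u n x) <= B) ->
  (forall n x, (N <= n)%nat -> D x -> Cmod (u n x) <= M) ->
  exists B, forall n x, D x -> Cmod (u n x) <= B.
Proof.
intros Hu; revert M; induction N as [|N IH]; intros M HM.
- exists M; intros n x; apply HM; lia.
- destruct (Hu N) as [B HB]; apply (IH (Rmax M B)); intros n x Hn Hx.
  destruct (Nat.eq_dec n N) as [->|Hn'].
  + eapply Rle_trans; [now apply HB|apply Rmax_r].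
  + eapply Rle_trans; [apply HM; [lia|exact Hx]|apply Rmax_l].
Qed.

Section Calculus.
Context {H : HilbertSpace}.

(** Regularity is carried along because [bc_plus] and [bc_mult] apply only to calculus functions. *)
Definition commuting_fun (Phi : (R -> C) -> BOp H) (S : BOp H) (f : R -> C) : Prop :=
  locally_Lipschitz f /\ S ** Phi f = Phi f ** S.

Lemma commuting_bernstein (T S : BOp H) Phi (phi : nat -> C) (p q : R) n :
  Borel_calculus T Phi -> S ** T = T ** S ->
  forall k, commuting_fun Phi S (fun x => bernstein phi (p * x + q) n k).
Proof.
intros HPhi HS.
assert (Cplus : forall f g, commuting_fun Phi S f -> commuting_fun Phi S g ->
          commuting_fun Phi S (fun x => f x + g x)%C).
{ intros f g [Lf Cf] [Lg Cg]; split; [now apply locally_Lipschitz_plus|].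
  rewrite (bc_plus _ _ HPhi) by now apply locally_Lipschitz_calculus.
  now rewrite op_mult_plus_l, op_mult_plus_r, Cf, Cg. }
assert (Cmult : forall f g, commuting_fun Phi S f -> commuting_fun Phi S g ->
          commuting_fun Phi S (fun x => f x * g x)%C).
{ intros f g [Lf Cf] [Lg Cg]; split; [now apply locally_Lipschitz_mult|].
  rewrite (bc_mult _ _ HPhi) by now apply locally_Lipschitz_calculus.
  now rewrite op_mult_assoc, Cf, <- op_mult_assoc, Cg, op_mult_assoc. }
assert (Cone : commuting_fun Phi S (fun _ => RtoC 1)).
{ split; [apply locally_Lipschitz_const|].
  now rewrite (bc_one _ _ HPhi), op_mult_one_l, op_mult_one_r. }
assert (Cconst : forall k, commuting_fun Phi S (fun _ => k)).
{ intros k; split; [apply locally_Lipschitz_const|].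
  replace (fun _ : R => k) with (fun _ : R => (k * RtoC 1)%C)
    by (apply functional_extensionality; intros; now rewrite Cmult_1_r).
  rewrite (bc_scal _ _ HPhi k (fun _ => RtoC 1)) by (apply locally_Lipschitz_calculus, locally_Lipschitz_const).
  now rewrite op_scal_mult_l, op_scal_mult_r, (proj2 Cone). }
assert (Cid : commuting_fun Phi S RtoC).
{ split; [apply locally_Lipschitz_id|]; now rewrite (bc_id _ _ HPhi). }
assert (Caff : forall p q, commuting_fun Phi S (fun x => RtoC (p * x + q))).
{ intros p' q'; replace (fun x => RtoC (p' * x + q'))
    with (fun x => RtoC p' * RtoC x + RtoC q')%C
    by (apply functional_extensionality; intros; now rewrite RtoC_plus, RtoC_mult).
  apply Cplus; [apply (Cmult (fun _ => RtoC p') RtoC); auto|auto]. }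
induction n as [|n IH]; intros k; simpl; [apply Cconst|].
apply Cplus; apply Cmult; auto.
replace (fun x => RtoC (1 - (p * x + q))) with (fun x => RtoC (- p * x + (1 - q)))
  by (apply functional_extensionality; intros x; apply (f_equal RtoC); ring).
apply Caff.
Qed.

(** [S] commutes with polynomials in [T]; these converge strongly to [Phi f], and [S] is continuous,
    so uniqueness of strong limits transfers commutation. *)
Lemma calculus_commutes (T S : BOp H) Phi f :
  Borel_calculus T Phi -> locally_Lipschitz f -> S ** T = T ** S ->
  S ** Phi f = Phi f ** S.
Proof.
intros HPhi Lf HS.
(* The index is shifted by one so that the interval has positive radius. Radius and precision
   improve together. *)
assert (App : forall n, exists g, commuting_fun Phi S g /\
  forall x, Rabs x <= INR (n + 1) -> Cmod (g x - f x) <= / INR (n + 1)).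
{ intros n; destruct (bernstein_approximation f (n + 1) Lf) as [m [Hm B]]; [lia|].
  assert (Hn : 0 < INR (n + 1)) by (apply (lt_INR 0); lia).
  eexists; split; [|exact B].
  replace (fun x => _) with (fun x =>
    bernstein (fun j => f (- INR (n + 1) + 2 * INR (n + 1) * INR j / INR (m * m)))
            (/ (2 * INR (n + 1)) * x + / 2) (m * m) 0).
  - now apply commuting_bernstein with T.
  - apply functional_extensionality; intros x; f_equal; field; lra. }
apply functional_choice in App; destruct App as [g Hg].
assert (Cg : forall n, calculus_fun (g n)) by (intros n; apply locally_Lipschitz_calculus, Hg).
assert (L : forall xi, filterlim (fun n => Phi (g n) xi) eventually (locally (Phi f xi))).
{ apply (bc_lim _ _ HPhi); auto using locally_Lipschitz_calculus.
  - intros A; destruct (locally_Lipschitz_bounded f Lf A) as [M HM].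
    destruct (INR_unbounded A) as [N HN].
    (* Once the radius exceeds [A] the error is at most [/ INR (n + 1) <= 1], hence [M + 1]. *)
    apply (uniform_bound _ (fun x => Rabs x <= A) N (M + 1)).
    + intros n; apply (Cg n).
    + intros n x Hn Hx; replace (g n x) with (f x + (g n x - f x))%C by ring.
      eapply Rle_trans; [apply Cmod_triangle|]; apply Rplus_le_compat; [now apply HM|].
      assert (INR N <= INR n) by now apply le_INR.
      pose proof (pos_INR n).
      eapply Rle_trans; [apply Hg; rewrite plus_INR; simpl; lra|].
      rewrite plus_INR; simpl; rewrite <- Rinv_1; apply Rinv_le_contravar; lra.
  - intros x; apply (filterlim_locally_ball_norm (U := C_NormedModule)); intros e.
    (* One index serves both purposes: [x] lies in the interval and the error is below [e]. *)
    destruct (INR_unbounded (Rabs x + / e)) as [N HN].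
    exists N; intros n Hn; change (Cmod (g n x - f x) < e).
    assert (INR N <= INR n) by now apply le_INR.
    pose proof (Rinv_0_lt_compat _ (cond_pos e)); pose proof (Rabs_pos x).
    eapply Rle_lt_trans; [apply Hg; rewrite plus_INR; simpl; lra|].
    rewrite plus_INR; simpl; rewrite <- (Rinv_inv e).
    apply Rinv_lt_contravar; [apply Rmult_lt_0_compat|]; lra. }
apply op_ext; intros xi.
apply (filterlim_locally_unique (V := H) (F := eventually) (fun n => S (Phi (g n) xi))).
- eapply filterlim_comp; [apply L|].
  apply (filterdiff_continuous (K := C_AbsRing) (V := H) (U := H) S).
  exists S; apply filterdiff_linear, op_linear.
- apply filterlim_ext with (fun n => Phi (g n) (S xi)); [|apply (L (S xi))].
  intros n; destruct (Hg n) as [[_ Cn] _].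
  change ((Phi (g n) ** S) xi = (S ** Phi (g n)) xi); now rewrite Cn.
Qed.

Lemma vn_fun_calc (N : BOp H -> Prop) f X Y :
  von_neumann_algebra N -> locally_Lipschitz f -> N X -> is_fun_calc f X Y -> N Y.
Proof.
intros HN Lf HX [Phi [HPhi ->]]; apply HN; intros S HS.
apply HN in HX; apply (calculus_commutes X S Phi f HPhi Lf); now apply HX.
Qed.

(** * Scalar operators and uniqueness of the calculus *)

Lemma op_norm_one_ge : (op_one : BOp H) <> op_zero -> 1 <= op_norm (op_one : BOp H).
Proof.
intros H1; pose proof (op_norm_ge_0 (op_one : BOp H)).
(* Submultiplicativity says that the norm of the identity is at most its own square, so it is 0 or
   at least 1. *)
pose proof (op_norm_mult (op_one : BOp H) op_one _ _ (Rle_refl _) (Rle_refl _)) as B.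
rewrite op_mult_one_l in B.
destruct (Req_dec (op_norm (op_one : BOp H)) 0) as [Z|Z]; [|nra].
destruct H1; now apply op_norm_eq_zero.
Qed.

Lemma op_norm_scalar_ge k :
  (op_one : BOp H) <> op_zero -> Cmod k <= op_norm (op_scal k op_one : BOp H).
Proof.
intros H1; destruct (Ceq_dec k 0) as [->|Hk].
{ rewrite Cmod_0; apply op_norm_ge_0. }
pose proof (op_norm_scal (/ k)%C (op_scal k op_one : BOp H)) as B.
replace (op_scal (/ k)%C (op_scal k op_one)) with (op_one : BOp H) in B.
- pose proof (op_norm_one_ge H1).
  assert (0 < Cmod k) by now apply Cmod_gt_0.
  rewrite Cmod_inv in B by exact Hk.
  apply (Rmult_le_compat_l (Cmod k)) in B; [|lra].
  rewrite <- Rmult_assoc, Rinv_r, Rmult_1_l in B by lra; nra.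
- apply op_ext; intros x; simpl; rewrite scal_assoc.
  change (mult (/ k)%C k) with (/ k * k)%C; rewrite Cinv_l by exact Hk.
  symmetry; apply (@scal_one C_Ring (CompleteNormedModule.ModuleSpace _ H)).
Qed.

Lemma inner_scal_r (k : C) (x y : H) : inner x (scal k y) = (Cconj k * inner x y)%C.
Proof. now rewrite inner_conj, inner_scal, Cmult_conj, <- inner_conj. Qed.

(** Evaluation at [r] is a calculus for the scalar operator. The operator Lipschitz condition
    concerns only operators with such a witness, so testing it on scalars requires this one. *)
Lemma scalar_calculus (r : R) :
  Borel_calculus (op_scal (RtoC r) op_one : BOp H) (fun f => op_scal (f r) op_one).
Proof.
constructor.
- reflexivity.
- apply op_ext; intros x; apply (@scal_one C_Ring (CompleteNormedModule.ModuleSpace _ H)).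
- intros f g _ _; apply op_ext; intros x.
  apply (@scal_distr_r C_Ring (CompleteNormedModule.ModuleSpace _ H)).
- intros k f _; apply op_ext; intros x; symmetry.
  apply (@scal_assoc C_Ring (CompleteNormedModule.ModuleSpace _ H)).
- intros f g _ _; apply op_ext; intros x; symmetry.
  apply (@scal_assoc C_Ring (CompleteNormedModule.ModuleSpace _ H)).
- intros f _ x y; simpl; now rewrite inner_scal_r, inner_scal, Cconj_conj.
- intros fn f _ _ _ L xi; specialize (L r).
  rewrite (filterlim_locally_ball_norm (U := C_NormedModule)) in L.
  apply (filterlim_locally_ball_norm (U := H)); intros e.
  pose proof (@norm_ge_0 C_AbsRing H xi) as Hxi.
  assert (He : 0 < e / (norm xi + 1)) by (apply Rdiv_lt_0_compat; [apply cond_pos|lra]).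
  destruct (L (mkposreal _ He)) as [N HN]; exists N; intros n Hn.
  specialize (HN n Hn); change (Cmod (fn n r - f r) < e / (norm xi + 1)) in HN.
  unfold ball_norm; simpl.
  assert (Es : minus (scal (fn n r) xi) (scal (f r) xi) = scal (fn n r - f r)%C xi).
  { unfold minus; rewrite <- (@scal_opp_l C_Ring (CompleteNormedModule.ModuleSpace _ H)).
    symmetry; apply (@scal_distr_r C_Ring (CompleteNormedModule.ModuleSpace _ H)). }
  eapply Rle_lt_trans; [right; exact (f_equal norm Es)|].
  eapply Rle_lt_trans; [apply (@norm_scal C_AbsRing H)|].
  change (abs (K := C_AbsRing) ?k) with (Cmod k).
  apply Rle_lt_trans with (e / (norm xi + 1) * norm xi).
  + apply Rmult_le_compat_r; lra.
  + apply Rlt_le_trans with (e / (norm xi + 1) * (norm xi + 1)); [nra|].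
    right; field; lra.
Qed.

(** Testing on scalar operators. *)
Lemma locally_operator_Lipschitz_scalar f :
  (op_one : BOp H) <> op_zero -> locally_operator_Lipschitz f -> locally_Lipschitz f.
Proof.
intros H1 [_ [_ Lf]] A; pose proof (Rabs_pos A).
destruct (Lf (Rabs A + 1)) as [K [HK L]]; [lra|].
exists K; split; [lra|]; intros x y Hx Hy.
assert (SA : forall r, self_adjoint (op_scal (RtoC r) op_one : BOp H)).
{ intros r u v; simpl; rewrite inner_scal_r, inner_scal.
  f_equal; apply injective_projections; simpl; ring. }
assert (NM : forall r, Rabs r <= A -> op_norm (op_scal (RtoC r) op_one : BOp H) < Rabs A + 1).
{ intros r Hr; eapply Rle_lt_trans; [apply op_norm_scal|].
  rewrite Cmod_R; pose proof op_norm_one (H := H); pose proof (Rle_abs A).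
  pose proof (Rabs_pos r); nra. }
assert (E : forall k l, minus (op_scal k op_one) (op_scal l op_one) = op_scal (k - l)%C (op_one : BOp H)).
{ intros k l; apply op_ext; intros u; simpl.
  rewrite (@scal_assoc C_Ring (CompleteNormedModule.ModuleSpace _ H)).
  rewrite <- (@scal_distr_r C_Ring (CompleteNormedModule.ModuleSpace _ H)).
  f_equal; apply injective_projections; simpl; unfold plus, mult; simpl; ring. }
specialize (L H _ _ (op_scal (f x) op_one) (op_scal (f y) op_one)
  (SA x) (SA y) (NM x Hx) (NM y Hy)).
rewrite !E, <- RtoC_minus in L.
eapply Rle_trans; [now apply op_norm_scalar_ge|].
eapply Rle_trans; [apply L; eexists; (split; [apply scalar_calculus|reflexivity])|].
apply Rmult_le_compat_l; [lra|].
eapply Rle_trans; [apply op_norm_scal|].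
rewrite Cmod_R; pose proof op_norm_one (H := H); pose proof (Rabs_pos (x - y)); nra.
Qed.

(** Apply the Lipschitz inequality with both operators equal to [X]. It identifies coefficients
    given by different witnesses [Phi]. *)
Lemma fun_calc_unique f (X Y Z : BOp H) :
  locally_operator_Lipschitz f -> self_adjoint X ->
  is_fun_calc f X Y -> is_fun_calc f X Z -> Y = Z.
Proof.
intros [_ [_ Lf]] HX HY HZ; pose proof (op_norm_ge_0 X).
destruct (Lf (op_norm X + 1)) as [K [HK L]]; [lra|].
apply op_norm_minus_eq.
eapply Rle_trans; [apply (L H X X); auto; lra|].
rewrite minus_eq_zero; pose proof (op_norm_zero (H := H)); change zero with (op_zero : BOp H); nra.
Qed.

End Calculus.
(** The algebra is matched as [?N], so the same tactic serves [M] and every [A t]; the von Neumann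
    property is found among the hypotheses. *)
Ltac vn_tac := repeat lazymatch goal with
  | |- ?N (plus _ _) => apply (vn_plus N)
  | |- ?N (minus _ _) => apply (vn_minus N)
  | |- ?N (opp _) => apply (vn_opp N)
  | |- ?N (op_mult _ _) => apply (vn_mult N)
  | |- ?N (op_scal _ _) => apply (vn_scal N)
  | |- ?N op_one => apply (vn_one N)
  | |- ?N op_zero => apply (vn_zero N)
  end; auto.

(** The phase [Cconj w / Cmod w] rotates [w] onto its modulus. Positivity of the trace controls real
    parts only, and this recovers the modulus. *)
Lemma Cmod_le_rotation (w : C) r :
  (forall k, Cmod k = 1 -> Re (k * w)%C <= r) -> Cmod w <= r.
Proof.
intros B; destruct (Ceq_dec w 0) as [->|Hw].
{ rewrite Cmod_0; specialize (B 1%C Cmod_1); rewrite Cmult_0_r in B; exact B. }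
assert (Hw' : 0 < Cmod w) by now apply Cmod_gt_0.
assert (Hr : RtoC (Cmod w) <> 0%C) by (intros Z; apply RtoC_inj in Z; lra).
replace (Cmod w) with (Re (Cconj w / RtoC (Cmod w) * w)%C).
- apply B; rewrite Cmod_div, Cmod_conj, Cmod_R, Rabs_pos_eq by (exact Hr || lra).
  field; lra.
- replace (Cconj w / RtoC (Cmod w) * w)%C with (RtoC (Cmod w)); [reflexivity|].
  replace (Cconj w / RtoC (Cmod w) * w)%C with (w * Cconj w / RtoC (Cmod w))%C by (field; exact Hr).
  rewrite <- Cmod2_conj, RtoC_pow; field; exact Hr.
Qed.

(** * Adjoints and quadratic forms *)

Section Forms.
Context {H : HilbertSpace}.
Implicit Types (S T : BOp H) (x y : H).

Lemma inner_plus_r x y z : inner x (plus y z : H) = (inner x y + inner x z)%C.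
Proof. now rewrite inner_conj, inner_plus, Cplus_conj, <- !inner_conj. Qed.

Lemma adjoint_sym S T : is_adjoint S T -> is_adjoint T S.
Proof. intros A x y; now rewrite inner_conj, <- A, <- inner_conj. Qed.

Lemma adjoint_plus S S' T T' :
  is_adjoint S S' -> is_adjoint T T' -> is_adjoint (plus S T) (plus S' T').
Proof.
intros A B x y; change (inner (plus (S x) (T x)) y = inner x (plus (S' y) (T' y))).
now rewrite inner_plus, inner_plus_r, A, B.
Qed.

Lemma adjoint_scal k T T' : is_adjoint T T' -> is_adjoint (op_scal k T) (op_scal (Cconj k) T').
Proof. intros A x y; simpl; now rewrite inner_scal, inner_scal_r, Cconj_conj, A. Qed.

Lemma adjoint_minus S S' T T' :
  is_adjoint S S' -> is_adjoint T T' -> is_adjoint (minus S T) (minus S' T').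
Proof.
intros A B; apply adjoint_plus; [exact A|].
change opp with (@op_opp H); unfold op_opp.
replace (RtoC (-1)) with (Cconj (RtoC (-1))) at 2
  by (apply injective_projections; simpl; ring).
now apply adjoint_scal.
Qed.

Lemma adjoint_mult S S' T T' :
  is_adjoint S S' -> is_adjoint T T' -> is_adjoint (S ** T) (T' ** S').
Proof. intros A B x y; simpl; now rewrite A, B. Qed.

Lemma adjoint_form T T' x : is_adjoint T T' -> inner (T' x) x = Cconj (inner (T x) x).
Proof. intros A; now rewrite A, <- inner_conj. Qed.

Lemma inner_mult_adjoint T T' x :
  is_adjoint T T' -> inner ((T' ** T) x) x = RtoC (norm (T x) ^ 2).
Proof. intros A; simpl; now rewrite (adjoint_sym _ _ A), inner_norm. Qed.

(** Expanding the square of [norm (T x - p x)] gives [2 p Re <T x, x> <= norm (T x) ^ 2 + p ^ 2 *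
    norm x ^ 2], and the right side is at most [2 * p ^ 2 * norm x ^ 2]. *)
Lemma form_le_norm T p x :
  op_norm T <= p -> 0 < p -> Re (inner (T x) x) <= p * norm x ^ 2.
Proof.
intros HT Hp.
assert (B : inner (plus (T x) (scal (RtoC (- p)) x)) (plus (T x) (scal (RtoC (- p)) x))
  = RtoC (norm (plus (T x) (scal (RtoC (- p)) x)) ^ 2)) by apply inner_norm.
rewrite !inner_plus, !inner_plus_r, !inner_scal, !inner_scal_r, !inner_norm in B.
rewrite (inner_conj H (T x) x) in B.
apply (f_equal Re) in B; simpl in B.
pose proof (pow2_ge_0 (norm (plus (T x) (scal (RtoC (- p)) x)))) as P; simpl in P.
pose proof (op_norm_apply T x); pose proof (@norm_ge_0 C_AbsRing H (T x)).
pose proof (@norm_ge_0 C_AbsRing H x).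
assert (norm (T x) <= p * norm x) by nra.
assert (norm (T x) * norm (T x) <= (p * norm x) * (p * norm x)) by nra.
unfold Re; apply Rmult_le_reg_l with (2 * p); [lra|]; simpl; nra.
Qed.

End Forms.

(** * Traces *)

Section Trace.
Context {H : HilbertSpace} (M : BOp H -> Prop) (E : BOp H -> C).
Context (HE : W_probability_space M E).
Implicit Types (S T P Q D : BOp H).

Let HM : von_neumann_algebra M := wps_algebra M E HE.

Lemma E_opp T : M T -> E (opp T) = (- E T)%C.
Proof.
intros HT; change (opp T) with (op_scal (RtoC (-1)) T).
rewrite (wps_scal _ _ HE) by exact HT; apply injective_projections; simpl; ring.
Qed.

Lemma E_minus S T : M S -> M T -> E (minus S T) = (E S - E T)%C.
Proof.
intros HS HT; unfold minus; rewrite (wps_plus _ _ HE), E_opp by vn_tac; reflexivity.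
Qed.

Lemma E_zero : E op_zero = 0%C.
Proof.
replace (op_zero : BOp H) with (minus op_one op_one : BOp H) by non_commutative_ring.
rewrite E_minus by vn_tac; ring.
Qed.

(** Adding the scalar [op_norm T + 1] makes [T] positive without changing the imaginary part of its
    trace. *)
Lemma E_self_adjoint T : M T -> self_adjoint T -> Im (E T) = 0.
Proof.
intros HT AT; pose proof (op_norm_ge_0 T).
assert (op_norm (opp T) <= op_norm T + 1) by (eapply Rle_trans; [apply (op_norm_opp T)|lra]).
destruct (wps_positive _ _ HE (plus (op_scal (RtoC (op_norm T + 1)) op_one) T)) as [I _].
- vn_tac.
- intros x.
  change (inner (plus (op_scal (RtoC (op_norm T + 1)) op_one) T x) x)
    with (inner (plus (scal (RtoC (op_norm T + 1)) x) (T x)) x).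
  rewrite inner_plus, inner_scal, inner_norm; split.
  + pose proof (f_equal Im (adjoint_form _ _ x AT)) as I; unfold Im in *; simpl in *; lra.
  + pose proof (form_le_norm (opp T) (op_norm T + 1) x ltac:(assumption) ltac:(lra)) as B.
    change (opp T x) with (scal (RtoC (-1)) (T x)) in B.
    rewrite inner_scal in B; unfold Re in *; simpl in *; lra.
- rewrite (wps_plus _ _ HE), (wps_scal _ _ HE), (wps_one _ _ HE) in I by vn_tac.
  unfold Im in *; simpl in *; lra.
Qed.

(** Both [T + T'] and [i (T - T')] are self-adjoint, hence have real traces. *)
Lemma E_adjoint T T' : M T -> M T' -> is_adjoint T T' -> E T' = Cconj (E T).
Proof.
intros HT HT' A.
assert (I1 : Im (E (plus T T')) = 0).
{ apply E_self_adjoint; [vn_tac|]; unfold self_adjoint; rewrite plus_comm at 2.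
  apply adjoint_plus; [exact A|now apply adjoint_sym]. }
assert (I2 : Im (E (op_scal Ci (minus T T'))) = 0).
{ apply E_self_adjoint; [vn_tac|]; unfold self_adjoint.
  replace (op_scal Ci (minus T T')) with (op_scal (Cconj Ci) (minus T' T)) at 2.
  - apply adjoint_scal, adjoint_minus; [exact A|now apply adjoint_sym].
  - rewrite <- (opp_minus T T'); change opp with (@op_opp H).
    apply op_ext; intros x; simpl; rewrite scal_assoc; f_equal.
    apply injective_projections; simpl; ring. }
rewrite (wps_plus _ _ HE) in I1 by vn_tac.
rewrite (wps_scal _ _ HE), E_minus in I2 by vn_tac.
apply injective_projections; unfold Re, Im in *; simpl in *; lra.
Qed.

Lemma vn_adjoint T : M T -> exists T', M T' /\ is_adjoint T T'.
Proof. apply HM. Qed.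

(** Adding the adjoint to [T - S] gives a positive operator with trace twice [Re (E T - E S)]; thus
    comparing real parts of the forms suffices. *)
Lemma E_monotone S T : M S -> M T ->
  (forall x, Re (inner (S x) x) <= Re (inner (T x) x)) -> Re (E S) <= Re (E T).
Proof.
intros HS HT L; destruct (vn_adjoint S HS) as [S' [HS' AS]].
destruct (vn_adjoint T HT) as [T' [HT' AT]].
destruct (wps_positive _ _ HE (plus (minus T S) (minus T' S'))) as [_ P].
- vn_tac.
- intros x; assert (I : inner (plus (minus T S) (minus T' S') x) x
    = (inner (T x) x - inner (S x) x + (inner (T' x) x - inner (S' x) x))%C).
  { change (inner (plus (plus (T x) (scal (RtoC (-1)) (S x)))
      (plus (T' x) (scal (RtoC (-1)) (S' x)))) x
      = (inner (T x) x - inner (S x) x + (inner (T' x) x - inner (S' x) x))%C).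
    rewrite !inner_plus, !inner_scal; apply injective_projections; simpl; ring. }
  rewrite I, (adjoint_form _ _ x AS), (adjoint_form _ _ x AT).
  specialize (L x); unfold Re, Im in *; split; simpl in *; lra.
- rewrite (wps_plus _ _ HE), !E_minus in P by vn_tac.
  rewrite (E_adjoint S S'), (E_adjoint T T') in P by auto.
  unfold Re in *; simpl in *; lra.
Qed.

Lemma E_re_le T p : M T -> op_norm T <= p -> 0 < p -> Re (E T) <= p.
Proof.
intros HT B Hp; replace p with (Re (E (op_scal (RtoC p) op_one))).
- apply E_monotone; [vn_tac|vn_tac|]; intros x; simpl op_fun.
  rewrite inner_scal, inner_norm; simpl.
  pose proof (form_le_norm T p x B Hp) as F; unfold Re in *; simpl in *; lra.
- rewrite (wps_scal _ _ HE), (wps_one _ _ HE) by vn_tac; simpl; ring.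
Qed.

Lemma E_bound T p : M T -> op_norm T <= p -> Cmod (E T) <= p.
Proof.
(* The slack [e] supplies the strict positivity that [E_re_le] demands. *)
intros HT B; pose proof (op_norm_ge_0 T); apply le_epsilon; intros e He.
apply Cmod_le_rotation; intros k Hk; rewrite <- (wps_scal _ _ HE) by exact HT.
apply E_re_le; [vn_tac| |lra].
eapply Rle_trans; [apply op_norm_scal|]; rewrite Hk; lra.
Qed.

Lemma E_minus_bound S T p : M S -> M T -> op_norm (minus S T) <= p ->
  Cmod (E S - E T) <= p.
Proof. intros HS HT B; rewrite <- E_minus by auto; apply E_bound; vn_tac. Qed.

Lemma E_sandwich D P p : M D -> M P -> self_adjoint D -> op_norm P <= p ->
  forall P', M P' -> is_adjoint P P' ->
  Re (E (D ** P' ** P ** D)) <= p ^ 2 * Re (E (D ** D)).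
Proof.
intros HD HP AD B P' HP' A.
replace (p ^ 2 * Re (E (D ** D))) with (Re (E (op_scal (RtoC (p ^ 2)) (D ** D)))).
- apply E_monotone; [vn_tac|vn_tac|]; intros x.
  replace (D ** P' ** P ** D) with ((D ** P') ** (P ** D)) by non_commutative_ring.
  rewrite (inner_mult_adjoint (P ** D) (D ** P')) by now apply adjoint_mult.
  change (op_scal (RtoC (p ^ 2)) (D ** D) x) with (scal (RtoC (p ^ 2)) ((D ** D) x)).
  rewrite inner_scal, inner_mult_adjoint by exact AD.
  pose proof (op_norm_apply P (D x)); pose proof (op_norm_ge_0 P).
  pose proof (@norm_ge_0 C_AbsRing H (D x)).
  pose proof (@norm_ge_0 C_AbsRing H (P (D x))).
  assert (norm (P (D x)) <= p * norm (D x)) by nra; simpl; nra.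
- rewrite (wps_scal _ _ HE) by vn_tac; unfold Re; simpl; ring.
Qed.

(** Cauchy-Schwarz for the trace. With [R = D P' - Q D], positivity of the adjoint of [R] times [R]
    bounds twice the left side by the traces of [P D D P'] and [D Q' Q D], and cyclicity brings the
    first to the form of [E_sandwich]. *)
Lemma E_quadratic_re D P Q p q : M D -> M P -> M Q -> self_adjoint D ->
  op_norm P <= p -> op_norm Q <= q ->
  Re (E (P ** D ** Q ** D)) <= (p ^ 2 + q ^ 2) / 2 * Re (E (D ** D)).
Proof.
intros HD HP HQ AD BP BQ.
destruct (vn_adjoint P HP) as [P' [HP' AP]]; destruct (vn_adjoint Q HQ) as [Q' [HQ' AQ]].
pose proof (E_sandwich D P p HD HP AD BP P' HP' AP) as B1.
pose proof (E_sandwich D Q q HD HQ AD BQ Q' HQ' AQ) as B2.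
assert (A : is_adjoint (minus (D ** P') (Q ** D)) (minus (P ** D) (D ** Q'))).
{ apply adjoint_minus; apply adjoint_mult; auto using adjoint_sym. }
destruct (wps_positive _ _ HE (minus (P ** D) (D ** Q') ** minus (D ** P') (Q ** D)))
  as [_ B].
- vn_tac.
- intros x; rewrite (inner_mult_adjoint _ _ x A); split; [reflexivity|apply pow2_ge_0].
- replace (minus (P ** D) (D ** Q') ** minus (D ** P') (Q ** D))
    with (minus (plus (P ** (D ** D ** P')) (D ** Q' ** Q ** D))
       (plus (P ** D ** Q ** D) (D ** Q' ** D ** P'))) in B by non_commutative_ring.
  rewrite E_minus, !(wps_plus _ _ HE), (wps_tracial _ _ HE P) in B by vn_tac.
  rewrite (E_adjoint (P ** D ** Q ** D) (D ** Q' ** D ** P')) in B; [|vn_tac|vn_tac|].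
  + replace (D ** D ** P' ** P) with (D ** (D ** P' ** P)) in B by non_commutative_ring.
    rewrite (wps_tracial _ _ HE D) in B by vn_tac.
    simpl in *; unfold Re in *; lra.
  + replace (D ** Q' ** D ** P') with (D ** (Q' ** (D ** P'))) by non_commutative_ring.
    apply adjoint_mult; [|exact AD]; apply adjoint_mult; [|exact AQ].
    now apply adjoint_mult.
Qed.

(** Rescaling [P] by [sqrt q] and [Q] by [/ sqrt q] makes the bound linear in [q]. *)
Lemma E_quadratic D P Q p q : M D -> M P -> M Q -> self_adjoint D ->
  op_norm P <= p -> op_norm Q <= q -> 0 < q ->
  Cmod (E (P ** D ** Q ** D)) <= q * (p ^ 2 + 1) / 2 * Re (E (D ** D)).
Proof.
intros HD HP HQ AD BP BQ Hq.
set (r := sqrt q); assert (Hr : 0 < r) by now apply sqrt_lt_R0.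
assert (Er : q = r * r) by (symmetry; apply sqrt_sqrt; lra).
pose proof (op_norm_ge_0 P).
apply Cmod_le_rotation; intros k Hk.
pose proof (E_quadratic_re D (op_scal (k * RtoC r) P) (op_scal (RtoC (/ r)) Q)
  (r * p) r HD) as B.
rewrite !op_scal_mult_l, op_scal_mult_r, op_scal_mult_l, !(wps_scal _ _ HE) in B by vn_tac.
replace (k * RtoC r * (RtoC (/ r) * E (P ** D ** Q ** D)))%C
  with (k * E (P ** D ** Q ** D))%C in B
  by (rewrite RtoC_inv by lra; field; intros Z; apply RtoC_inj in Z; lra).
eapply Rle_trans; [apply B|].
- vn_tac.
- vn_tac.
- exact AD.
- eapply Rle_trans; [apply op_norm_scal|].
  rewrite Cmod_mult, Hk, Cmod_R, Rabs_pos_eq by lra; nra.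
- eapply Rle_trans; [apply op_norm_scal|].
  pose proof (Rinv_0_lt_compat _ Hr).
  rewrite Cmod_R, Rabs_pos_eq by lra.
  apply Rle_trans with (/ r * q); [nra|]; rewrite Er; right; field; lra.
- rewrite Er; right; field.
Qed.

End Trace.
(** * The semicircle law *)

(** The substitution [x = 2 * sqrt v * sin theta]. *)
Lemma semicircle_moment (n : nat) (v : R) (F : R -> R) : 0 < v ->
  (forall y, is_derive F y ((2 * sqrt v * sin y) ^ n * (2 / PI * (cos y) ^ 2))) ->
  RInt (fun x => x ^ n * semicircle_density v x) (- (2 * sqrt v)) (2 * sqrt v)
    = F (PI / 2) - F (- (PI / 2)) :> R.
Proof.
intros Hv DF; pose proof PI_RGT_0 as HPI.
assert (Hs : 0 < sqrt v) by now apply sqrt_lt_R0.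
assert (Ev : sqrt v * sqrt v = v) by (apply sqrt_sqrt; lra).
rewrite <- (Rmult_1_r (2 * sqrt v)), Ropp_mult_distr_r.
rewrite <- sin_PI2 at 2; rewrite <- sin_PI2 at 1; rewrite <- sin_neg.
rewrite <- (RInt_comp (fun x => x ^ n * semicircle_density v x)
  (fun y => 2 * sqrt v * sin y) (fun y => 2 * sqrt v * cos y)).
- apply is_RInt_unique.
  apply is_RInt_ext with (fun y => (2 * sqrt v * sin y) ^ n * (2 / PI * (cos y) ^ 2)).
  + intros y; rewrite Rmin_left, Rmax_right by lra; intros Hy.
    (* The cosine is nonnegative on this range, so the root in the density becomes
       [2 * sqrt v * cos y]. *)
    assert (Hc : 0 <= cos y) by (apply cos_ge_0; lra).
    unfold semicircle_density.
    replace (4 * v - (2 * sqrt v * sin y) ^ 2) with (Rsqr (2 * sqrt v * cos y)).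
    * rewrite sqrt_Rsqr by nra; unfold scal; simpl; unfold mult; simpl.
      revert Hs Ev; generalize (sqrt v); intros q Hq <-; field; lra.
    * pose proof (sin2_cos2 y) as SC; unfold Rsqr in *; nra.
  + apply (is_RInt_derive (V := R_CompleteNormedModule)); [intros; apply DF|].
    intros y _; apply (ex_derive_continuous (V := R_NormedModule)); auto_derive; auto.
- intros y _; unfold semicircle_density.
  apply (continuous_mult (K := R_AbsRing)).
  + apply (ex_derive_continuous (V := R_NormedModule)); auto_derive; auto.
  + apply (continuous_mult (K := R_AbsRing)); [|apply continuous_const].
    apply continuous_sqrt_comp.
    apply (ex_derive_continuous (V := R_NormedModule)); auto_derive; auto.
- intros y _; split; [auto_derive; [exact I|simpl; ring]|].
  apply (ex_derive_continuous (V := R_NormedModule)); auto_derive; auto.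
Qed.

Lemma semicircle_mean v : 0 < v ->
  RInt (fun x => x ^ 1 * semicircle_density v x) (- (2 * sqrt v)) (2 * sqrt v) = 0 :> R.
Proof.
intros Hv; pose proof PI_RGT_0.
rewrite (semicircle_moment 1 v (fun y => - (4 * sqrt v / (3 * PI)) * (cos y) ^ 3) Hv).
- rewrite cos_neg, cos_PI2; ring.
- intros y; auto_derive; auto; field; lra.
Qed.

Lemma semicircle_variance v : 0 < v ->
  RInt (fun x => x ^ 2 * semicircle_density v x) (- (2 * sqrt v)) (2 * sqrt v) = v :> R.
Proof.
intros Hv; pose proof PI_RGT_0.
assert (Ev : sqrt v * sqrt v = v) by (apply sqrt_sqrt; lra).
(* An antiderivative of [8 * v / PI * (sin y) ^ 2 * (cos y) ^ 2]. Its trigonometric terms vanish at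
   both ends, leaving [v / PI * PI]. *)
rewrite (semicircle_moment 2 v
  (fun y => v / PI * (y + 2 * (sin y) ^ 3 * cos y - sin y * cos y)) Hv).
- rewrite cos_neg, sin_neg, cos_PI2, sin_PI2; field; lra.
- intros y; auto_derive; auto.
  replace ((2 * sqrt v * sin y) ^ 2) with (4 * v * (sin y) ^ 2) 
    by (transitivity (4 * (sqrt v * sqrt v) * (sin y) ^ 2); [rewrite Ev; ring|ring]).
  assert (SC : (cos y) ^ 2 = 1 - (sin y) ^ 2)
    by (pose proof (sin2_cos2 y) as SC; unfold Rsqr in SC; simpl; lra).
  apply Rmult_eq_reg_r with (PI / v); [|apply Rgt_not_eq, Rdiv_lt_0_compat; lra].
  field_simplify; [|lra|lra].
  replace ((cos y) ^ 2) with (1 - (sin y) ^ 2); ring.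
Qed.

(** * Free increments *)

Section Increment.
Context {H : HilbertSpace} (M : BOp H -> Prop) (E : BOp H -> C).
Context (HE : W_probability_space M E).
Context (N : BOp H -> Prop) (HN : von_neumann_algebra N) (HNM : forall T, N T -> M T).
Context (T : BOp H) (v : R) (HT : M T) (Hfree : free_from E T N).
Context (Hmean : E T = 0%C) (Hvar : E (T ** T) = RtoC v).
Implicit Types (Y : BOp H).

Let HM : von_neumann_algebra M := wps_algebra M E HE.

(** Freeness speaks of centred letters only; since [N] is unital, removing the mean stays inside
    [N]. *)
Lemma centering Y : exists Y0, N Y -> N Y0 /\ E Y0 = 0%C /\ Y = plus Y0 (op_scal (E Y) op_one).
Proof.
exists (minus Y (op_scal (E Y) op_one)); intros HY; repeat split.
- vn_tac.
- rewrite (E_minus M E HE), (wps_scal _ _ HE), (wps_one _ _ HE) by vn_tac; ring.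
- non_commutative_ring.
Qed.

Lemma free_mean Y : N Y -> E (Y ** T) = 0%C.
Proof.
intros HY; destruct (centering Y) as [Y0 HC]; destruct (HC HY) as [HY0 [E0 ->]].
rewrite op_mult_plus_l, op_scal_mult_l, op_mult_one_l.
rewrite (wps_plus _ _ HE), (wps_scal _ _ HE), Hmean by vn_tac.
replace (E (Y0 ** T)) with (RtoC 0); [ring|symmetry].
rewrite <- (op_mult_one_r T).
apply (Hfree ((false, Y0) :: (true, T) :: nil)); [discriminate| |].
- repeat constructor; discriminate.
- repeat constructor; auto.
Qed.

(** [T ** T - v] is a centred element of the algebra generated by [T], so freeness applies to a word
    of two letters. *)
Lemma free_square Y : N Y -> E (Y ** T ** T) = (RtoC v * E Y)%C.
Proof.
intros HY; destruct (centering Y) as [Y0 HC]; destruct (HC HY) as [HY0 [E0 EY]].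
set (k := E Y) in *; set (Q := plus (T ** T) (op_scal (- RtoC v)%C op_one)).
assert (HQ : M Q) by (unfold Q; vn_tac).
assert (F : E (Y0 ** Q) = 0%C).
{ rewrite <- (op_mult_one_r Q).
  apply (Hfree ((false, Y0) :: (true, Q) :: nil)); [discriminate| |].
  - repeat constructor; discriminate.
  - repeat constructor; auto.
    unfold Q; simpl snd.
    rewrite (wps_plus _ _ HE), (wps_scal _ _ HE), (wps_one _ _ HE), Hvar by vn_tac; ring. }
replace (Y ** T ** T)
  with (plus (Y0 ** Q) (plus (op_scal (RtoC v) Y0) (op_scal k (T ** T)))).
- rewrite !(wps_plus _ _ HE), !(wps_scal _ _ HE), F, E0, Hvar by vn_tac; ring.
- rewrite EY; unfold Q.
  rewrite !op_mult_plus_l, !op_mult_plus_r, !op_scal_mult_l, !op_scal_mult_r, op_mult_one_l, op_mult_one_r.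
  replace (op_scal (- RtoC v)%C Y0) with (opp (op_scal (RtoC v) Y0)); [non_commutative_ring|].
  change opp with (@op_opp H); apply op_ext; intros x; simpl; rewrite scal_assoc; f_equal.
  apply injective_projections; simpl; unfold mult; simpl; ring.
Qed.

(** After centring [Y1] and [Y2], the alternating word of four letters has trace zero, and the
    remaining terms reduce to [free_square], one of them by cyclicity. This is the source of the
    product of expectations. *)
Lemma free_quadratic Y1 Y2 : N Y1 -> N Y2 ->
  E (Y1 ** T ** Y2 ** T) = (RtoC v * (E Y1 * E Y2))%C.
Proof.
intros HY1 HY2.
destruct (centering Y1) as [Z1 HC1]; destruct (HC1 HY1) as [HZ1 [E1 EY1]].
destruct (centering Y2) as [Z2 HC2]; destruct (HC2 HY2) as [HZ2 [E2 EY2]].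
assert (F : E (Z1 ** T ** Z2 ** T) = 0%C).
{ replace (Z1 ** T ** Z2 ** T) with (Z1 ** (T ** (Z2 ** (T ** op_one)))) by non_commutative_ring.
  apply (Hfree ((false, Z1) :: (true, T) :: (false, Z2) :: (true, T) :: nil)); [discriminate| |].
  - repeat constructor; discriminate.
  - repeat constructor; auto. }
assert (F1 : E (T ** Y2 ** T) = (RtoC v * E Y2)%C).
{ rewrite <- op_mult_assoc, (wps_tracial _ _ HE) by vn_tac; now apply free_square. }
replace (Y1 ** T ** Y2 ** T) with (plus (Z1 ** T ** Z2 ** T)
  (plus (op_scal (E Y2) (Z1 ** T ** T)) (op_scal (E Y1) (T ** Y2 ** T)))).
- rewrite !(wps_plus _ _ HE), !(wps_scal _ _ HE), F, F1, (free_square Z1), E1 by vn_tac; ring.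
- transitivity (plus (Z1 ** T ** Y2 ** T) (op_scal (E Y1) (T ** Y2 ** T))).
  + rewrite plus_assoc; f_equal.
    transitivity (Z1 ** T ** plus Z2 (op_scal (E Y2) op_one) ** T); [|now rewrite <- EY2].
    now rewrite !op_mult_plus_r, !op_mult_plus_l, !op_scal_mult_r, !op_scal_mult_l, op_mult_one_r.
  + transitivity (plus Z1 (op_scal (E Y1) op_one) ** T ** Y2 ** T); [|now rewrite <- EY1].
    now rewrite !op_mult_plus_l, !op_scal_mult_l, op_mult_one_l.
Qed.

End Increment.
(** * Stochastic sums *)

Section Stochastic.
Context {H : HilbertSpace} (M : BOp H -> Prop) (E : BOp H -> C).
Context (A : R -> BOp H -> Prop) (W : R -> BOp H).
Context (HE : W_probability_space M E) (HA : filtration M A) (HW : free_brownian_motion E A W).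
Implicit Types (Y : BOp H).

Let HM : von_neumann_algebra M := wps_algebra M E HE.

Lemma increment_in s r p : 0 <= s <= r -> r <= p -> A p (minus (W r) (W s)).
Proof.
intros Hs Hr; pose proof (filt_algebra _ _ HA p ltac:(lra)).
apply vn_minus; auto.
- apply (filt_mono _ _ HA r); [lra|apply (fbm_adapted _ _ _ HW); lra].
- apply (filt_mono _ _ HA s); [lra|apply (fbm_adapted _ _ _ HW); lra].
Qed.

Lemma increment_mean s r Y : 0 <= s < r -> A s Y -> E (Y ** minus (W r) (W s)) = 0%C.
Proof.
intros Hs HY; apply (free_mean M E HE (A s)).
- apply (filt_algebra _ _ HA); lra.
- intros T; apply (filt_sub _ _ HA); lra.
- apply (filt_sub _ _ HA r); [lra|apply increment_in; lra].
- now apply (fbm_free _ _ _ HW).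
- pose proof (fbm_semicircular _ _ _ HW s r Hs 1%nat) as S.
  rewrite semicircle_mean in S by lra; simpl in S; now rewrite op_mult_one_r in S.
- exact HY.
Qed.

Lemma increment_quadratic s r Y1 Y2 : 0 <= s < r -> A s Y1 -> A s Y2 ->
  E (Y1 ** minus (W r) (W s) ** Y2 ** minus (W r) (W s)) = (RtoC (r - s) * (E Y1 * E Y2))%C.
Proof.
intros Hs HY1 HY2; apply (free_quadratic M E HE (A s)); auto.
- apply (filt_algebra _ _ HA); lra.
- intros T; apply (filt_sub _ _ HA); lra.
- apply (filt_sub _ _ HA r); [lra|apply increment_in; lra].
- now apply (fbm_free _ _ _ HW).
- pose proof (fbm_semicircular _ _ _ HW s r Hs 1%nat) as S.
  rewrite semicircle_mean in S by lra; simpl in S; now rewrite op_mult_one_r in S.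
- pose proof (fbm_semicircular _ _ _ HW s r Hs 2%nat) as S.
  rewrite semicircle_variance in S by lra; simpl in S; now rewrite op_mult_one_r in S.
Qed.

Section Sums.
Context (u v : R -> BOp H) (t : nat -> R).

(** The coefficients are taken at left end points, hence in the past of their increment; the
    recursion peels off the last increment, the one free from everything else. *)
Fixpoint stoch_sum (n : nat) : BOp H :=
  match n with
  | O => op_zero
  | S m => plus (stoch_sum m) (u (t m) ** minus (W (t (S m))) (W (t m)) ** v (t m))
  end.

(** The steps are strict because freeness and the semicircle law are stated for increments of
    positive length. *)
Definition adapted_partition (n : nat) : Prop :=
  0 <= t 0%nat /\
  forall i, (i < n)%nat -> t i < t (S i) /\ A (t i) (u (t i)) /\ A (t i) (v (t i)).

Lemma adapted_partition_S n : adapted_partition (S n) -> adapted_partition n.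
Proof. intros [H0 Hp]; split; auto. Qed.

Lemma adapted_partition_le n : adapted_partition n -> t 0%nat <= t n.
Proof.
induction n as [|n IH]; intros Hp; [lra|].
pose proof (IH (adapted_partition_S _ Hp)); destruct Hp as [_ Hp].
destruct (Hp n (Nat.lt_succ_diag_r n)); lra.
Qed.

Lemma stoch_sum_adapted n : adapted_partition n -> A (t n) (stoch_sum n).
Proof.
induction n as [|n IH]; intros Hp; simpl.
{ apply vn_zero, (filt_algebra _ _ HA), Hp. }
pose proof (adapted_partition_le n (adapted_partition_S _ Hp)) as L.
specialize (IH (adapted_partition_S _ Hp)); destruct Hp as [H0 Hp].
destruct (Hp n (Nat.lt_succ_diag_r n)) as [Ht [Hu Hv]].
pose proof (filt_algebra _ _ HA (t (S n)) ltac:(lra)).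
assert (Mono : forall Y, A (t n) Y -> A (t (S n)) Y) by (intros Y; apply (filt_mono _ _ HA); lra).
pose proof (increment_in (t n) (t (S n)) (t (S n)) ltac:(lra) (Rle_refl _)) as HD.
set (D := minus (W (t (S n))) (W (t n))) in *; vn_tac.
Qed.

Lemma stoch_sum_mean n Y : adapted_partition n -> A (t 0%nat) Y -> E (Y ** stoch_sum n) = 0%C.
Proof.
intros Hp HY; induction n as [|n IH]; simpl.
{ replace (Y ** op_zero) with (op_zero : BOp H) by non_commutative_ring.
  apply (E_zero M E HE). }
pose proof (adapted_partition_le n (adapted_partition_S _ Hp)) as L.
pose proof (stoch_sum_adapted n (adapted_partition_S _ Hp)) as HS.
specialize (IH (adapted_partition_S _ Hp)); destruct Hp as [H0 Hp].
destruct (Hp n (Nat.lt_succ_diag_r n)) as [Ht [Hu Hv]].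
pose proof (filt_algebra _ _ HA (t n) ltac:(lra)).
assert (HY' : A (t n) Y) by (apply (filt_mono _ _ HA (t 0%nat)); auto).
assert (Sub : forall Z, A (t n) Z -> M Z) by (intros Z; apply (filt_sub _ _ HA); lra).
set (D := minus (W (t (S n))) (W (t n))).
assert (HD : M D) by (apply (filt_sub _ _ HA (t (S n))); [lra|apply increment_in; lra]).
rewrite op_mult_plus_r, (wps_plus _ _ HE), IH by vn_tac.
replace (Y ** (u (t n) ** D ** v (t n))) with ((Y ** u (t n) ** D) ** v (t n)) by non_commutative_ring.
rewrite (wps_tracial _ _ HE) by vn_tac.
replace (v (t n) ** (Y ** u (t n) ** D)) with ((v (t n) ** Y ** u (t n)) ** D) by non_commutative_ring.
unfold D; rewrite increment_mean; [ring|lra|vn_tac].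
Qed.

(** The cross terms vanish because the last increment is free from all the rest. *)
Lemma stoch_sum_quadratic n Y1 Y2 (k : C) (e : R) :
  adapted_partition n -> A (t 0%nat) Y1 -> A (t 0%nat) Y2 ->
  (forall i, (i < n)%nat ->
     Cmod (E (v (t i) ** Y1 ** u (t i)) * E (v (t i) ** Y2 ** u (t i)) - k) <= e) ->
  Cmod (E (Y1 ** stoch_sum n ** Y2 ** stoch_sum n) - RtoC (t n - t 0%nat) * k)
    <= e * (t n - t 0%nat).
Proof.
intros Hp HY1 HY2; induction n as [|n IH]; intros He; simpl stoch_sum.
{ replace (Y1 ** op_zero ** Y2 ** op_zero) with (op_zero : BOp H) by non_commutative_ring.
  rewrite (E_zero M E HE), !Rminus_diag.
  replace (0 - RtoC 0 * k)%C with (RtoC 0) by ring; rewrite Cmod_0; lra. }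
pose proof (adapted_partition_le n (adapted_partition_S _ Hp)) as L.
pose proof (stoch_sum_adapted n (adapted_partition_S _ Hp)) as HS.
specialize (IH (adapted_partition_S _ Hp) ltac:(auto)); destruct Hp as [H0 Hp].
destruct (Hp n (Nat.lt_succ_diag_r n)) as [Ht [Hu Hv]].
specialize (He n (Nat.lt_succ_diag_r n)).
pose proof (filt_algebra _ _ HA (t n) ltac:(lra)).
assert (HY1' : A (t n) Y1) by (apply (filt_mono _ _ HA (t 0%nat)); auto).
assert (HY2' : A (t n) Y2) by (apply (filt_mono _ _ HA (t 0%nat)); auto).
assert (Sub : forall Z, A (t n) Z -> M Z) by (intros Z; apply (filt_sub _ _ HA); lra).
set (D := minus (W (t (S n))) (W (t n))).
assert (HD : M D) by (apply (filt_sub _ _ HA (t (S n))); [lra|apply increment_in; lra]).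
set (S0 := stoch_sum n) in *; set (b := u (t n)) in *; set (c := v (t n)) in *.
(* Cyclicity moves all that follows [D] to the front, where it joins an element of [A (t n)]. *)
assert (X1 : E (Y1 ** S0 ** Y2 ** (b ** D ** c)) = 0%C).
{ replace (Y1 ** S0 ** Y2 ** (b ** D ** c))
    with ((Y1 ** S0 ** Y2 ** b ** D) ** c) by non_commutative_ring.
  rewrite (wps_tracial _ _ HE) by vn_tac.
  replace (c ** (Y1 ** S0 ** Y2 ** b ** D))
    with ((c ** Y1 ** S0 ** Y2 ** b) ** D) by non_commutative_ring.
  apply increment_mean; [lra|vn_tac]. }
assert (X2 : E (Y1 ** (b ** D ** c) ** Y2 ** S0) = 0%C).
{ replace (Y1 ** (b ** D ** c) ** Y2 ** S0)
    with ((Y1 ** b ** D) ** (c ** Y2 ** S0)) by non_commutative_ring.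
  rewrite (wps_tracial _ _ HE) by vn_tac.
  replace (c ** Y2 ** S0 ** (Y1 ** b ** D))
    with ((c ** Y2 ** S0 ** Y1 ** b) ** D) by non_commutative_ring.
  apply increment_mean; [lra|vn_tac]. }
assert (X3 : E (Y1 ** (b ** D ** c) ** Y2 ** (b ** D ** c))
  = (RtoC (t (S n) - t n) * (E (c ** Y1 ** b) * E (c ** Y2 ** b)))%C).
{ replace (Y1 ** (b ** D ** c) ** Y2 ** (b ** D ** c))
    with ((Y1 ** b ** D ** c ** Y2 ** b ** D) ** c) by non_commutative_ring.
  rewrite (wps_tracial _ _ HE) by vn_tac.
  replace (c ** (Y1 ** b ** D ** c ** Y2 ** b ** D))
    with ((c ** Y1 ** b) ** D ** (c ** Y2 ** b) ** D) by non_commutative_ring.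
  apply increment_quadratic; [lra|vn_tac|vn_tac]. }
replace (Y1 ** plus S0 (b ** D ** c) ** Y2 ** plus S0 (b ** D ** c))
  with (plus (plus (Y1 ** S0 ** Y2 ** S0) (Y1 ** S0 ** Y2 ** (b ** D ** c)))
    (plus (Y1 ** (b ** D ** c) ** Y2 ** S0) (Y1 ** (b ** D ** c) ** Y2 ** (b ** D ** c))))
  by non_commutative_ring.
rewrite !(wps_plus _ _ HE), X1, X2, X3 by vn_tac.
set (w := (E (c ** Y1 ** b) * E (c ** Y2 ** b))%C) in *.
set (z := E (Y1 ** S0 ** Y2 ** S0)) in *.
replace (z + 0 + (0 + RtoC (t (S n) - t n) * w) - RtoC (t (S n) - t 0%nat) * k)%C
  with ((z - RtoC (t n - t 0%nat) * k) + RtoC (t (S n) - t n) * (w - k))%C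
  by (rewrite !RtoC_minus; ring).
eapply Rle_trans; [apply Cmod_triangle|].
rewrite Cmod_mult, Cmod_R, Rabs_pos_eq by lra.
apply (Rmult_le_compat_l (t (S n) - t n)) in He; lra.
Qed.

End Sums.

(** A partition that fits both integrals is a partition of [0, s] followed by one of [s, r]. *)
Lemma integral_increment (u v : R -> BOp H) s r (J1 J2 : BOp H) e :
  0 <= s < r -> 0 < e ->
  is_free_integral W u v 0 s J1 -> is_free_integral W u v 0 r J2 ->
  exists (n : nat) (t : nat -> R), t 0%nat = s /\ t n = r /\
    (forall i, (i < n)%nat -> s <= t i < t (S i) /\ t (S i) <= r) /\
    op_norm (minus (stoch_sum u v t n) (minus J2 J1)) < e.
Proof.
intros Hs He I1 I2.
destruct (I1 (e / 2)) as [d1 [Hd1 B1]]; [lra|].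
destruct (I2 (e / 2)) as [d2 [Hd2 B2]]; [lra|].
assert (Hd : 0 < Rmin d1 d2) by now apply Rmin_pos.
pose proof (Rmin_l d1 d2) as Hl1; pose proof (Rmin_r d1 d2) as Hl2.
(* Both halves get [n] equal steps, of length at most [r / INR n], so one mesh bound serves both
   integrals. *)
destruct (INR_unbounded (r / Rmin d1 d2)) as [n Hn].
assert (Hr0 : 0 < r / Rmin d1 d2) by (apply Rdiv_lt_0_compat; lra).
assert (Hn0 : 0 < INR n) by lra.
assert (Hmesh : r / INR n < Rmin d1 d2).
{ apply Rmult_lt_reg_r with (INR n); [lra|].
  replace (r / INR n * INR n) with (r / Rmin d1 d2 * Rmin d1 d2) by (field; lra).
  rewrite (Rmult_comm (Rmin d1 d2)); apply Rmult_lt_compat_r; lra. }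
(* For [s = 0] the first half consists of steps of length zero, which [is_free_integral] admits; the
   second half, the one that is kept, always has strict steps. *)
set (t := fun i => if (i <=? n)%nat then s * (INR i / INR n)
                   else s + (r - s) * ((INR i - INR n) / INR n)).
assert (T1 : forall i, (i <= n)%nat -> t i = s * (INR i / INR n)).
{ intros i Hi; unfold t; now rewrite (proj2 (Nat.leb_le i n) Hi). }
assert (T2 : forall i, (n <= i)%nat -> t i = s + (r - s) * ((INR i - INR n) / INR n)).
{ intros i Hi; unfold t; destruct (Nat.leb_spec i n) as [Hi'|Hi']; [|reflexivity].
  replace i with n by lia; field; lra. }
assert (S1 : forall i, (i < n)%nat -> t (S i) - t i = s / INR n).
{ intros i Hi; rewrite !T1, S_INR by lia; field; lra. }
assert (S2 : forall i, (n <= i)%nat -> t (S i) - t i = (r - s) / INR n).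
{ intros i Hi; rewrite !T2, S_INR by lia; field; lra. }
assert (Q1 : 0 <= s / INR n) by (apply Rdiv_le_0_compat; lra).
assert (Q2 : 0 < (r - s) / INR n) by (apply Rdiv_lt_0_compat; lra).
assert (Q3 : s / INR n + (r - s) / INR n = r / INR n) by (field; lra).
assert (Step : forall i, 0 <= t (S i) - t i < Rmin d1 d2).
{ intros i; destruct (Nat.le_gt_cases n i); [rewrite S2|rewrite S1]; auto; lra. }
assert (P0 : t 0%nat = 0) by (rewrite T1 by lia; simpl; field; lra).
assert (Pn : t n = s) by (rewrite T1 by lia; field; lra).
assert (P2n : t (n + n)%nat = r) by (rewrite T2, plus_INR by lia; field; lra).
assert (Pos : forall i, 0 <= t i).
{ induction i as [|i IH]; [lra|destruct (Step i); lra]. }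
assert (Fine : forall i, (1 <= i)%nat ->
  t (pred i) <= t i /\ 0 <= t (pred i) <= t (pred i) /\ t i - t (pred i) < Rmin d1 d2).
{ intros [|i] Hi; [lia|]; simpl; destruct (Step i); pose proof (Pos i); lra. }
set (a := fun i => u (t (pred i)) ** minus (W (t i)) (W (t (pred i))) ** v (t (pred i))).
assert (C1 : op_norm (minus (sum_n_m a 1 n) J1) < e / 2).
{ apply (B1 n t (fun i => t (pred i)) P0 Pn); intros i [Hi _].
  destruct (Fine i Hi) as [F1 [F2 F3]]; repeat split; lra. }
assert (C2 : op_norm (minus (sum_n_m a 1 (n + n)) J2) < e / 2).
{ apply (B2 (n + n)%nat t (fun i => t (pred i)) P0 P2n); intros i [Hi _].
  destruct (Fine i Hi) as [F1 [F2 F3]]; repeat split; lra. }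
assert (Es : forall k, sum_n_m a (S n) (n + k) = stoch_sum u v (fun i => t (n + i)%nat) k).
{ induction k as [|k IH]; simpl.
  - rewrite sum_n_m_zero by lia; reflexivity.
  - rewrite Nat.add_succ_r, sum_n_Sm, IH by lia; reflexivity. }
exists n, (fun i => t (n + i)%nat); rewrite Nat.add_0_r; repeat split; auto.
- rewrite T2 by lia; rewrite plus_INR.
  replace (INR n + INR i - INR n) with (INR i) by ring.
  pose proof (Rdiv_le_0_compat _ _ (pos_INR i) Hn0); nra.
- rewrite Nat.add_succ_r; specialize (S2 (n + i)%nat ltac:(lia)); lra.
- rewrite T2 by lia; rewrite plus_INR.
  replace (INR n + INR (S i) - INR n) with (INR (S i)) by ring.
  assert (INR (S i) <= INR n) by (apply le_INR; lia).
  assert (INR (S i) / INR n <= 1).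
  { apply Rmult_le_reg_r with (INR n); [lra|]; unfold Rdiv; rewrite Rmult_assoc, Rinv_l; lra. }
  nra.
(* The second half is the difference of the full sum and the first half, each within [e / 2] of its
   integral. *)
- rewrite <- Es, (sum_n_m_Chasles a 1 n (n + n)) in * by lia.
  set (S1' := sum_n_m a 1 n) in *; set (S2' := sum_n_m a (S n) (n + n)) in *.
  change (@plus _ S1' S2') with (plus S1' S2' : BOp H) in C2.
  replace (minus S2' (minus J2 J1))
    with (minus (minus (plus S1' S2' : BOp H) J2) (minus S1' J1)) by non_commutative_ring.
  eapply Rle_lt_trans; [apply op_norm_minus|lra].
Qed.

(** * Moments of an increment of the stochastic integral *)

Section Increment.
Context (u v : R -> BOp H) (s r : R) (J1 J2 : BOp H).
Context (Hs : 0 <= s < r).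
Context (Hu : forall p, s <= p <= r -> A p (u p)) (Hv : forall p, s <= p <= r -> A p (v p)).
Context (HJ1 : is_free_integral W u v 0 s J1) (HJ2 : is_free_integral W u v 0 r J2).

Lemma integral_approximation e : 0 < e ->
  exists n t, t 0%nat = s /\ t n = r /\
    (forall i, (i < n)%nat -> s <= t i <= r) /\ adapted_partition u v t n /\
    M (stoch_sum u v t n) /\ op_norm (minus (stoch_sum u v t n) (minus J2 J1)) < e.
Proof.
intros He; destruct (integral_increment u v s r J1 J2 e Hs He HJ1 HJ2)
  as [n [t [T0 [Tn [Ht B]]]]].
assert (Hp : adapted_partition u v t n).
{ split; [lra|]; intros i Hi; specialize (Ht i Hi).
  repeat split; [lra|apply Hu; lra|apply Hv; lra]. }
exists n, t; split; [exact T0|split; [exact Tn|split; [|split; [exact Hp|split; [|exact B]]]]].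
- intros i Hi; specialize (Ht i Hi); lra.
- apply (filt_sub _ _ HA (t n)); [lra|now apply stoch_sum_adapted].
Qed.

(** The integral is defined by norm limits that do not mention [M]; its increment is a limit of sums
    in [M], which is norm closed. *)
Lemma integral_in : M (minus J2 J1).
Proof.
apply (vn_norm_closed M HM); intros e He.
destruct (integral_approximation e He) as [n [t [_ [_ [_ [_ [HS B]]]]]]]; eauto.
Qed.

Lemma integral_mean Y : A s Y -> E (Y ** minus J2 J1) = 0%C.
Proof.
intros HY; pose proof integral_in as HJ.
assert (HY' : M Y) by (apply (filt_sub _ _ HA s); [lra|exact HY]).
apply Cmod_eq_0, Rle_antisym; [|apply Cmod_ge_0]; apply le_epsilon; intros e He.
pose proof (op_norm_ge_0 Y) as HN.
assert (He' : 0 < e / (op_norm Y + 1)) by (apply Rdiv_lt_0_compat; lra).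
destruct (integral_approximation _ He') as [n [t [T0 [Tn [Ht [Hp [HS B]]]]]]].
set (S0 := stoch_sum u v t n) in *; set (J := minus J2 J1) in *.
replace (E (Y ** J)) with (E (Y ** J) - E (Y ** S0))%C.
- eapply Rle_trans; [apply (E_minus_bound M E HE _ _ (op_norm Y * (e / (op_norm Y + 1)))); vn_tac|].
  + replace (minus (Y ** J) (Y ** S0)) with (Y ** minus J S0) by non_commutative_ring.
    apply op_norm_mult; [lra|rewrite op_norm_minus_sym; lra].
  + rewrite Rplus_0_l; apply Rle_trans with ((op_norm Y + 1) * (e / (op_norm Y + 1))); [nra|].
    right; field; lra.
- unfold S0; rewrite stoch_sum_mean; [ring|exact Hp|now rewrite T0].
Qed.

Lemma integral_quadratic Y1 Y2 (k : C) (e : R) : A s Y1 -> A s Y2 ->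
  (forall p, s <= p <= r -> Cmod (E (v p ** Y1 ** u p) * E (v p ** Y2 ** u p) - k) <= e) ->
  Cmod (E (Y1 ** minus J2 J1 ** Y2 ** minus J2 J1) - RtoC (r - s) * k) <= e * (r - s).
Proof.
intros HY1 HY2 He; pose proof integral_in as HJ.
assert (HY1' : M Y1) by (apply (filt_sub _ _ HA s); [lra|exact HY1]).
assert (HY2' : M Y2) by (apply (filt_sub _ _ HA s); [lra|exact HY2]).
apply le_epsilon; intros d Hd.
set (J := minus J2 J1) in *.
pose proof (op_norm_ge_0 Y1) as N1; pose proof (op_norm_ge_0 Y2) as N2.
pose proof (op_norm_ge_0 J) as NJ.
(* Replacing [J] by a sum within [x <= 1] of it, whose norm is at most [op_norm J + 1], costs
   [x * (B0 - 1)]; the last [+ 1] keeps [B0] positive. *)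
set (B0 := op_norm Y1 * op_norm Y2 * (2 * op_norm J + 1) + 1).
assert (HB0 : 1 <= B0).
{ unfold B0; assert (0 <= op_norm Y1 * op_norm Y2) by nra; nra. }
assert (Hd' : 0 < Rmin 1 (d / B0)) by (apply Rmin_pos; [lra|apply Rdiv_lt_0_compat; lra]).
destruct (integral_approximation _ Hd') as [n [t [T0 [Tn [Ht [Hp [HS B]]]]]]].
fold J in B; pose proof (Rmin_l 1 (d / B0)); pose proof (Rmin_r 1 (d / B0)).
assert (Q : Cmod (E (Y1 ** stoch_sum u v t n ** Y2 ** stoch_sum u v t n)
    - RtoC (r - s) * k) <= e * (r - s)).
{ replace (r - s) with (t n - t 0%nat) by now rewrite T0, Tn.
  apply stoch_sum_quadratic; [exact Hp|now rewrite T0|now rewrite T0|].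
  intros i Hi; apply He, Ht, Hi. }
set (S0 := stoch_sum u v t n) in *.
replace (E (Y1 ** J ** Y2 ** J) - RtoC (r - s) * k)%C
  with ((E (Y1 ** S0 ** Y2 ** S0) - RtoC (r - s) * k)
    + (E (Y1 ** J ** Y2 ** J) - E (Y1 ** S0 ** Y2 ** S0)))%C by ring.
eapply Rle_trans; [apply Cmod_triangle|apply Rplus_le_compat; [exact Q|]].
set (x := Rmin 1 (d / B0)) in *.
assert (NS : op_norm (minus J S0) <= x) by (rewrite op_norm_minus_sym; lra).
assert (NS' : op_norm S0 <= op_norm J + 1) by (apply (op_norm_near J); lra).
eapply Rle_trans.
- apply (E_minus_bound M E HE); [vn_tac|vn_tac|].
  apply (op_norm_mult_minus _ _ _ _ (op_norm Y1 * op_norm J * op_norm Y2) (op_norm J + 1)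
    (op_norm Y1 * x * op_norm Y2) x); [|exact NS'| |exact NS].
  + repeat apply op_norm_mult; lra.
  + replace (minus (Y1 ** J ** Y2) (Y1 ** S0 ** Y2))
      with (Y1 ** minus J S0 ** Y2) by non_commutative_ring.
    repeat apply op_norm_mult; lra.
- apply Rle_trans with (x * B0).
  + apply Rle_trans with (x * (B0 - 1)); [right; unfold B0; ring|nra].
  + apply Rle_trans with (d / B0 * B0); [apply Rmult_le_compat_r; lra|].
    right; field; lra.
Qed.

End Increment.
End Stochastic.
(** * The expansion of the resolvent *)

Lemma resolvent_identity {H : HilbertSpace} (X Y G F : BOp H) z :
  is_resolvent X z G -> is_resolvent Y z F -> F = minus G (G ** minus Y X ** F).
Proof.
intros [GL GR] [FL FR].
replace (minus Y X) with
  (minus (minus Y (op_scal z op_one)) (minus X (op_scal z op_one))) by non_commutative_ring.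
set (Yz := minus Y (op_scal z op_one)) in *; set (Xz := minus X (op_scal z op_one)) in *.
replace (G ** minus Yz Xz ** F) with (minus (G ** (Yz ** F)) (G ** Xz ** F)) by non_commutative_ring.
rewrite FR, GL; non_commutative_ring.
Qed.

Section Expansion.
Context {H : HilbertSpace} (M : BOp H -> Prop) (E : BOp H -> C).
Context (HE : W_probability_space M E).

Let HM : von_neumann_algebra M := wps_algebra M E HE.

(** [I] and [J] are the increments of the drift and of the martingale part.
    The cubic remainder is controlled by [E (D ** D)], which is linear in the
    time step, times the small operator norm of [D]. *)
Lemma resolvent_trace_expansion (Gt Gs Gr D I J a : BOp H) (kappa : C) (K eta h d : R) :
  M Gt -> M Gs -> M Gr -> M D -> M I -> M J -> M a ->
  1 <= K -> 0 < eta <= 1 -> 0 <= h <= eta ->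
  self_adjoint D -> D = plus I J -> Gr = minus Gs (Gs ** D ** Gr) ->
  op_norm Gt <= K -> op_norm Gs <= K -> op_norm Gr <= K -> op_norm a <= K ->
  op_norm (minus Gs Gt) <= eta -> op_norm D <= 2 * eta ->
  op_norm I <= 2 * K * h ->
  op_norm (minus I (op_scal (RtoC h) a)) <= eta * h ->
  E (Gs ** Gs ** J) = 0%C ->
  Cmod (E (Gs ** Gs ** J ** Gs ** J) - RtoC h * kappa) <= d ->
  Cmod (E (J ** J)) <= K ^ 4 * h ->
  Cmod (E Gr - E Gs - RtoC h * (- E (a ** op_pow Gt 2) + kappa))
    <= d + (3 * K ^ 2 + 4 * K ^ 4 + 8 * K ^ 5
            + K ^ 2 * (K ^ 4 + 1) * (K ^ 4 + 4 * K + 8 * K ^ 2)) * eta * h.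
Proof.
intros MGt MGs MGr MD MI MJ Ma HK Heta Hh SD ED EG NGt NGs NGr Na NG ND NI NIa EJ1 EJ2 EJJ.
assert (HKh : 0 <= K * h) by nra.
assert (NJ : op_norm J <= 4 * K * eta).
{ replace J with (minus D I) by (rewrite ED; non_commutative_ring).
  eapply Rle_trans; [apply op_norm_minus|]; nra. }
(* One error [eta] comes from replacing [I] by [h a], and one from each factor [Gs] replaced by
   [Gt]: hence the constant 3. *)
assert (B1 : Cmod (E (Gs ** Gs ** I) - RtoC h * E (a ** op_pow Gt 2)) <= 3 * K ^ 2 * (eta * h)).
{ rewrite <- (wps_scal _ _ HE) by (simpl; vn_tac).
  replace (E (op_scal (RtoC h) (a ** op_pow Gt 2))) with (E (Gt ** Gt ** op_scal (RtoC h) a)).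
  - apply (E_minus_bound M E HE); [vn_tac|vn_tac|].
    apply Rle_trans with (K * K * (eta * h) + (K * eta + eta * K) * (h * K)); [|right; ring].
    apply op_norm_mult_minus; [now apply op_norm_mult| |now apply op_norm_mult_minus|exact NIa].
    eapply Rle_trans; [apply op_norm_scal|]; rewrite Cmod_R, Rabs_pos_eq by lra; nra.
  - simpl; rewrite op_mult_one_r, op_scal_mult_r, !(wps_scal _ _ HE) by vn_tac.
    now rewrite (wps_tracial _ _ HE (Gt ** Gt) a) by vn_tac. }
(* In the mixed terms [I] contributes [h] and the other increment contributes [eta]. *)
assert (B2 : Cmod (E (Gs ** Gs ** I ** Gs ** D)) <= 4 * K ^ 4 * (eta * h)).
{ apply (E_bound M E HE); [vn_tac|].
  apply Rle_trans with (K * K * (2 * K * h) * K * (2 * eta)); [|right; ring].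
  repeat apply op_norm_mult; auto. }
assert (B3 : Cmod (E (Gs ** Gs ** J ** Gs ** I)) <= 8 * K ^ 5 * (eta * h)).
{ apply (E_bound M E HE); [vn_tac|].
  apply Rle_trans with (K * K * (4 * K * eta) * K * (2 * K * h)); [|right; ring].
  repeat apply op_norm_mult; auto. }
assert (B4 : Re (E (D ** D)) <= (K ^ 4 + 4 * K + 8 * K ^ 2) * h).
{ eapply Rle_trans; [apply Rle_abs|]; eapply Rle_trans; [apply re_le_Cmod|].
  replace (D ** D) with (plus (J ** J) (plus (I ** D) (J ** I)))
    by (rewrite ED; non_commutative_ring).
  rewrite !(wps_plus _ _ HE) by vn_tac.
  assert (C1 : Cmod (E (I ** D)) <= (2 * K * h) * (2 * eta))
    by (apply (E_bound M E HE); [vn_tac|now apply op_norm_mult]).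
  assert (C2 : Cmod (E (J ** I)) <= (4 * K * eta) * (2 * K * h))
    by (apply (E_bound M E HE); [vn_tac|now apply op_norm_mult]).
  eapply Rle_trans; [apply Cmod_triangle|].
  pose proof (Cmod_triangle (E (I ** D)) (E (J ** I))).
  assert (0 <= (2 * K * h) * (1 - eta)) by (apply Rmult_le_pos; nra).
  assert (0 <= (4 * K * (2 * K * h)) * (1 - eta)) by (apply Rmult_le_pos; nra).
  lra. }
(* The cubic remainder after a cyclic rotation. The middle [D] is hidden in the second coefficient
   [Gs ** D ** Gs], of norm at most [2 * K ^ 2 * eta], and [E_quadratic] is linear in that norm. *)
assert (B5 : Cmod (E (Gr ** Gs ** D ** (Gs ** D ** Gs) ** D))
  <= K ^ 2 * (K ^ 4 + 1) * (K ^ 4 + 4 * K + 8 * K ^ 2) * (eta * h)).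
{ eapply Rle_trans.
  - apply (E_quadratic M E HE D _ _ (K * K) (K * (2 * eta) * K)); [vn_tac|vn_tac|vn_tac|auto| | |].
    + now apply op_norm_mult.
    + repeat apply op_norm_mult; auto.
    + repeat apply Rmult_lt_0_compat; lra.
  - apply Rle_trans with (K * (2 * eta) * K * ((K * K) ^ 2 + 1) / 2
      * ((K ^ 4 + 4 * K + 8 * K ^ 2) * h)); [|right; field].
    apply Rmult_le_compat_l; [|exact B4].
    pose proof (pow2_ge_0 (K * K)); apply Rmult_le_pos; [|lra].
    repeat apply Rmult_le_pos; lra. }
(* Substituting this from the inside outwards collapses the last term of the expansion, which is
   therefore exact. *)
assert (EX : Gs ** D ** Gr = minus Gs Gr) by (rewrite EG at 2; non_commutative_ring).
assert (EGr : Gr = minus (plus (minus Gs (Gs ** D ** Gs)) (Gs ** D ** Gs ** D ** Gs))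
                     (Gs ** D ** Gs ** D ** Gs ** D ** Gr)).
{ replace (Gs ** D ** Gs ** D ** Gs ** D ** Gr)
    with (Gs ** D ** (Gs ** D ** (Gs ** D ** Gr))) by non_commutative_ring.
  rewrite EX.
  replace (Gs ** D ** (Gs ** D ** minus Gs Gr))
    with (minus (Gs ** D ** Gs ** D ** Gs) (Gs ** D ** (Gs ** D ** Gr))) by non_commutative_ring.
  rewrite EX.
  replace (Gs ** D ** minus Gs Gr)
    with (minus (Gs ** D ** Gs) (Gs ** D ** Gr)) by non_commutative_ring.
  rewrite EX; non_commutative_ring. }
assert (T1 : E (Gs ** D ** Gs) = E (Gs ** Gs ** I)).
{ rewrite (wps_tracial _ _ HE) by vn_tac.
  replace (Gs ** (Gs ** D)) with (plus (Gs ** Gs ** I) (Gs ** Gs ** J))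
    by (rewrite ED; non_commutative_ring).
  rewrite (wps_plus _ _ HE), EJ1 by vn_tac; ring. }
assert (T2 : E (Gs ** D ** Gs ** D ** Gs) = (E (Gs ** Gs ** J ** Gs ** J)
  + (E (Gs ** Gs ** I ** Gs ** D) + E (Gs ** Gs ** J ** Gs ** I)))%C).
{ rewrite (wps_tracial _ _ HE), <- !(wps_plus _ _ HE) by vn_tac.
  f_equal; rewrite ED; non_commutative_ring. }
assert (T3 : E (Gs ** D ** Gs ** D ** Gs ** D ** Gr)
  = E (Gr ** Gs ** D ** (Gs ** D ** Gs) ** D)).
{ rewrite (wps_tracial _ _ HE) by vn_tac; f_equal; non_commutative_ring. }
assert (EE : E Gr = (E Gs - E (Gs ** Gs ** I)
  + (E (Gs ** Gs ** J ** Gs ** J)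
     + (E (Gs ** Gs ** I ** Gs ** D) + E (Gs ** Gs ** J ** Gs ** I)))
  - E (Gr ** Gs ** D ** (Gs ** D ** Gs) ** D))%C).
{ rewrite EGr at 1.
  rewrite (E_minus M E HE), (wps_plus _ _ HE), (E_minus M E HE), T1, T2, T3 by vn_tac.
  reflexivity. }
rewrite EE.
set (e1 := E (Gs ** Gs ** I)) in *; set (e2 := E (Gs ** Gs ** J ** Gs ** J)) in *.
set (e3 := E (Gs ** Gs ** I ** Gs ** D)) in *; set (e4 := E (Gs ** Gs ** J ** Gs ** I)) in *.
set (e5 := E (Gr ** Gs ** D ** (Gs ** D ** Gs) ** D)) in *.
set (e6 := E (a ** op_pow Gt 2)) in *.
replace (E Gs - e1 + (e2 + (e3 + e4)) - e5 - E Gs - RtoC h * (- e6 + kappa))%C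
  with ((e2 - RtoC h * kappa) + (- (e1 - RtoC h * e6) + (e3 + (e4 + - e5))))%C by ring.
eapply Rle_trans; [apply Cmod_triangle|].
eapply Rle_trans; [apply Rplus_le_compat; [exact EJ2|apply Cmod_triangle]|].
pose proof (Cmod_triangle e3 (e4 + - e5)); pose proof (Cmod_triangle e4 (- e5)) as L.
rewrite Cmod_opp in L |- *; lra.
Qed.

End Expansion.
(** * The differential equation *)

Lemma drift_increment {H : HilbertSpace} (f : R -> BOp H) (T I1 I2 : BOp H) s r p e :
  s <= r -> is_RInt f 0 s I1 -> is_RInt f 0 r I2 ->
  (forall x, s <= x <= r -> op_norm (f x) <= p /\ op_norm (minus (f x) T) <= e) ->
  op_norm (minus I2 I1) <= (r - s) * p /\
  op_norm (minus (minus I2 I1) (op_scal (RtoC (r - s)) T)) <= e * (r - s).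
Proof.
intros Hs H1 H2 B.
assert (HI : is_RInt f s r (minus I2 I1)).
{ replace (minus I2 I1) with (plus (opp I1) I2 : BOp H) by non_commutative_ring.
  exact (is_RInt_Chasles (V := BOp_NormedModule) f s 0 r _ _
    (is_RInt_swap (V := BOp_NormedModule) f s 0 I1 H1) H2). }
split.
- apply (norm_RInt_le_const (V := BOp_NormedModule) f); [exact Hs| |exact HI].
  intros x Hx; apply B, Hx.
- rewrite Rmult_comm.
  apply (norm_RInt_le_const (V := BOp_NormedModule) (fun x => minus (f x) T));
    [exact Hs| |apply (is_RInt_minus f (fun _ => T)); [exact HI|apply (is_RInt_const (V := BOp_NormedModule) s r T)]].
  intros x Hx; apply B, Hx.
Qed.

Section Equation.
Context {H : HilbertSpace} (M : BOp H -> Prop) (E : BOp H -> C).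
Context (A : R -> BOp H -> Prop) (W : R -> BOp H).
Context (HE : W_probability_space M E) (HA : filtration M A) (HW : free_brownian_motion E A W).

Let HM : von_neumann_algebra M := wps_algebra M E HE.

(** The term [7 * K ^ 6] is the variation of the product of expectations: 4 from the four factors of
    [c G G b] and 3 from those of [c G b]. The rest comes from [resolvent_trace_expansion]. *)
Definition resolvent_constant (K : R) : R :=
  7 * K ^ 6 + (3 * K ^ 2 + 4 * K ^ 4 + 8 * K ^ 5
               + K ^ 2 * (K ^ 4 + 1) * (K ^ 4 + 4 * K + 8 * K ^ 2)).

Lemma resolvent_increment (X G a b c : R -> BOp H) (z : C) (X0 I1 I2 J1 J2 : BOp H)
    (t s r K eta : R) :
  0 <= s < r -> s <= t <= r -> r - s <= eta -> 1 <= K -> 0 < eta <= 1 ->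
  (forall p, s <= p <= r ->
     (A p (X p) /\ self_adjoint (X p) /\ A p (a p) /\ A p (b p) /\ A p (c p)) /\
     is_resolvent (X p) z (G p) /\
     (op_norm (a p) <= K /\ op_norm (b p) <= K /\ op_norm (c p) <= K /\ op_norm (G p) <= K) /\
     op_norm (minus (X p) (X t)) <= eta /\ op_norm (minus (a p) (a t)) <= eta /\
     op_norm (minus (b p) (b t)) <= eta /\ op_norm (minus (c p) (c t)) <= eta /\
     op_norm (minus (G p) (G t)) <= eta) ->
  is_RInt a 0 s I1 -> is_RInt a 0 r I2 ->
  is_free_integral W b c 0 s J1 -> is_free_integral W b c 0 r J2 ->
  X s = plus X0 (plus I1 J1) -> X r = plus X0 (plus I2 J2) ->
  Cmod (E (G r) - E (G s) - RtoC (r - s) *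
      (- E (a t ** op_pow (G t) 2)
       + E (b t ** c t ** G t) * E (b t ** c t ** op_pow (G t) 2)))
    <= resolvent_constant K * eta * (r - s).
Proof.
intros Hs Ht Hh HK Heta B HI1 HI2 HJ1 HJ2 EX1 EX2.
assert (Sub : forall p T, s <= p <= r -> A p T -> M T)
  by (intros p T Hp; apply (filt_sub _ _ HA); lra).
assert (AG : forall p, s <= p <= r -> A p (G p)).
{ intros p Hp; destruct (B p Hp) as [[AX _] [RG _]].
  apply (vn_resolvent (A p) (filt_algebra _ _ HA p ltac:(lra)) (X p) z); auto. }
assert (MG : forall p, s <= p <= r -> M (G p)) by (intros p Hp; apply (Sub p); auto).
assert (MX : forall p, s <= p <= r -> M (X p)) by (intros p Hp; apply (Sub p); auto; apply B, Hp).
assert (Ma : forall p, s <= p <= r -> M (a p)) by (intros p Hp; apply (Sub p); auto; apply B, Hp).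
assert (Mb : forall p, s <= p <= r -> M (b p)) by (intros p Hp; apply (Sub p); auto; apply B, Hp).
assert (Mc : forall p, s <= p <= r -> M (c p)) by (intros p Hp; apply (Sub p); auto; apply B, Hp).
assert (Hss : s <= s <= r) by lra; assert (Hrr : s <= r <= r) by lra.
assert (Hb : forall p, s <= p <= r -> A p (b p)) by (intros p Hp; apply B, Hp).
assert (Hc : forall p, s <= p <= r -> A p (c p)) by (intros p Hp; apply B, Hp).
pose proof (filt_algebra _ _ HA s ltac:(lra)) as HAs.
pose proof (AG s Hss) as AGs.
destruct (drift_increment a (a t) I1 I2 s r K eta) as [NI NIa]; try assumption; [lra| |].
{ intros x Hx; split; apply (B x Hx). }
set (J := minus J2 J1); set (I := minus I2 I1) in *; set (D := minus (X r) (X s)).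
assert (ED : D = plus I J).
{ unfold D, I, J; rewrite EX1, EX2; non_commutative_ring. }
assert (MJ : M J) by (apply (integral_in M E A W HE HA HW b c s r); auto).
assert (MD : M D) by (unfold D; vn_tac).
assert (MI : M I) by (replace I with (minus D J) by (rewrite ED; non_commutative_ring); vn_tac).
assert (NGt := proj2 (proj2 (proj2 (proj1 (proj2 (proj2 (B t Ht))))))).
assert (NGs := proj2 (proj2 (proj2 (proj1 (proj2 (proj2 (B s Hss))))))).
assert (NGr := proj2 (proj2 (proj2 (proj1 (proj2 (proj2 (B r Hrr))))))).
assert (NG : op_norm (minus (G s) (G t)) <= eta) by apply (B s Hss).
replace (resolvent_constant K * eta * (r - s))
  with (7 * K ^ 6 * eta * (r - s)
    + (3 * K ^ 2 + 4 * K ^ 4 + 8 * K ^ 5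
       + K ^ 2 * (K ^ 4 + 1) * (K ^ 4 + 4 * K + 8 * K ^ 2)) * eta * (r - s))
  by (unfold resolvent_constant; ring).
apply (resolvent_trace_expansion M E HE (G t) (G s) (G r) D I J (a t)); auto.
- lra.
- apply adjoint_minus; [apply (B r Hrr)|apply (B s Hss)].
- apply (resolvent_identity (X s) (X r) (G s) (G r) z); [apply (B s Hss)|apply (B r Hrr)].
- apply (B t Ht).
- replace D with (minus (minus (X r) (X t)) (minus (X s) (X t))) by (unfold D; non_commutative_ring).
  eapply Rle_trans; [apply op_norm_minus|].
  assert (op_norm (minus (X r) (X t)) <= eta) by apply (B r Hrr).
  assert (op_norm (minus (X s) (X t)) <= eta) by apply (B s Hss).
  lra.
- nra.
- apply (integral_mean M E A W HE HA HW b c s r); auto; vn_tac.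
(* The quadratic variation produces the order [c G b]; cyclicity turns it into the order [b c G] of
   the statement. *)
- replace (E (b t ** c t ** G t)) with (E (c t ** G t ** b t)).
  + replace (E (b t ** c t ** op_pow (G t) 2)) with (E (c t ** (G t ** G t) ** b t)).
    * apply (integral_quadratic M E A W HE HA HW b c s r); auto; [vn_tac|].
      intros p Hp.
      destruct (B p Hp) as [_ [_ [[_ [Nb [Nc NGp]]] [_ [_ [Db [Dc DG]]]]]]].
      destruct (B t Ht) as [_ [_ [[_ [Nbt [Nct _]]] _]]].
      set (x1 := E (c p ** (G s ** G s) ** b p)); set (x2 := E (c p ** G s ** b p)).
      set (y1 := E (c t ** (G t ** G t) ** b t)); set (y2 := E (c t ** G t ** b t)).
      assert (C1 : Cmod (x1 - y1) <= K * (K * K) * eta + (K * (K * eta + eta * K) + eta * (K * K)) * K).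
      { apply (E_minus_bound M E HE); [vn_tac|vn_tac|].
        repeat first [apply op_norm_mult_minus | apply op_norm_mult]; auto. }
      assert (C2 : Cmod (x2 - y2) <= K * K * eta + (K * eta + eta * K) * K).
      { apply (E_minus_bound M E HE); [vn_tac|vn_tac|].
        repeat first [apply op_norm_mult_minus | apply op_norm_mult]; auto. }
      assert (C3 : Cmod x1 <= K * (K * K) * K)
        by (apply (E_bound M E HE); [vn_tac|repeat apply op_norm_mult; auto]).
      assert (C4 : Cmod y2 <= K * K * K)
        by (apply (E_bound M E HE); [vn_tac|repeat apply op_norm_mult; auto]).
      replace (x1 * x2 - y2 * y1)%C with (x1 * (x2 - y2) + (x1 - y1) * y2)%C by ring.
      eapply Rle_trans; [apply Cmod_triangle|]; rewrite !Cmod_mult.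
      apply Rle_trans with (K * (K * K) * K * (K * K * eta + (K * eta + eta * K) * K)
        + (K * (K * K) * eta + (K * (K * eta + eta * K) + eta * (K * K)) * K) * (K * K * K));
        [|right; ring].
      apply Rplus_le_compat; apply Rmult_le_compat; auto using Cmod_ge_0.
    * simpl; rewrite op_mult_one_r, (wps_tracial _ _ HE) by vn_tac.
      f_equal; non_commutative_ring.
  + rewrite (wps_tracial _ _ HE) by vn_tac; f_equal; non_commutative_ring.
(* With both [Y] equal to the identity and target 0, the quadratic formula becomes a crude bound on
   [E (J ** J)]. *)
- pose proof (integral_quadratic M E A W HE HA HW b c s r J1 J2 Hs Hb Hc HJ1 HJ2
    op_one op_one 0 (K ^ 4)) as Q.
  rewrite op_mult_one_l, op_mult_one_r, Cmult_0_r in Q.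
  replace (E (J ** J)) with (E (J ** J) - 0)%C by ring; apply Q; [now apply vn_one|now apply vn_one|].
  intros p Hp; destruct (B p Hp) as [_ [_ [[_ [Nb [Nc _]]] _]]].
  replace (E (c p ** op_one ** b p) * E (c p ** op_one ** b p) - 0)%C
    with (E (c p ** b p) * E (c p ** b p))%C by (rewrite op_mult_one_r; ring).
  rewrite Cmod_mult; replace (K ^ 4) with ((K * K) * (K * K)) by ring.
  assert (Cmod (E (c p ** b p)) <= K * K)
    by (apply (E_bound M E HE); [vn_tac|now apply op_norm_mult]).
  apply Rmult_le_compat; auto using Cmod_ge_0.
Qed.

End Equation.
(** The resolvent identity bounds [F - G] in terms of the norm of [F]; smallness lets half of that
    norm be absorbed, so it is at most [2 * op_norm G]. *)
Lemma resolvent_lipschitz {H : HilbertSpace} (X Y G F : BOp H) z :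
  is_resolvent X z G -> is_resolvent Y z F ->
  op_norm (minus Y X) * op_norm G <= / 2 ->
  op_norm (minus F G) <= 2 * op_norm G ^ 2 * op_norm (minus Y X).
Proof.
intros RG RF Hs; pose proof (resolvent_identity X Y G F z RG RF) as EF.
pose proof (op_norm_ge_0 G); pose proof (op_norm_ge_0 F); pose proof (op_norm_ge_0 (minus Y X)).
assert (B : op_norm (minus F G) <= op_norm G * op_norm (minus Y X) * op_norm F).
{ replace (minus F G) with (opp (G ** minus Y X ** F)) by (rewrite EF at 2; non_commutative_ring).
  eapply Rle_trans; [apply op_norm_opp|]; repeat apply op_norm_mult; apply Rle_refl. }
pose proof (op_norm_near G F _ _ (Rle_refl _) B).
assert (op_norm F <= 2 * op_norm G) by nra.
eapply Rle_trans; [exact B|].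
assert (0 <= op_norm G * op_norm (minus Y X)) by nra; nra.
Qed.

Lemma norm_C_R (w : C) : norm (w : C_R_NormedModule) = Cmod w.
Proof.
destruct w as [x y]; unfold norm, Cmod; simpl; unfold prod_norm, norm; simpl.
unfold abs; simpl; f_equal; pose proof (pow2_abs x); pose proof (pow2_abs y); simpl in *; lra.
Qed.

(** Taking [r = t] or [s = t] gives the left and right difference quotients; at an end point of [D]
    only one of them occurs. *)
Lemma is_derive_within_epsilon (D : R -> Prop) (g : R -> C) (t : R) (l : C) :
  D t ->
  (forall e, 0 < e -> exists d, 0 < d /\ forall s r, D s -> D r -> s < r -> s <= t <= r ->
     Rabs (s - t) < d -> Rabs (r - t) < d ->
     Cmod (g r - g s - RtoC (r - s) * l) <= e * (r - s)) ->
  is_derive_within D g t l.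
Proof.
intros Dt B; split; [apply (is_linear_scal_l (K := R_AbsRing) (V := C_R_NormedModule))|].
intros x Hx.
(* [filterdiff] quantifies over all limit points [x] of the filter. As [t] itself lies in [D], a
   ball around [x] of radius [Rabs (x - t)] excludes any other limit. *)
assert (Ex : x = t).
{ destruct (Req_dec x t) as [|Hxt]; [assumption|exfalso].
  assert (Hp : 0 < Rabs (x - t)) by (apply Rabs_pos_lt; lra).
  destruct (Hx (fun y => Rabs (y - x) < Rabs (x - t))) as [d Hd].
  - exists (mkposreal _ Hp); intros y Hy; exact Hy.
  - specialize (Hd t (ball_center t d) Dt).
    rewrite Rabs_minus_sym in Hd; lra. }
subst x; intros e; destruct (B e (cond_pos e)) as [d [Hd Bd]].
exists (mkposreal d Hd); intros y Hy Dy; change (Rabs (y - t) < d) in Hy.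
rewrite norm_C_R; change (norm (minus y t)) with (Rabs (y - t)).
change (Cmod (g y - g t - scal (V := C_R_NormedModule) (y - t) l) <= e * Rabs (y - t)).
replace (scal (V := C_R_NormedModule) (y - t) l : C) with (RtoC (y - t) * l)%C
  by (destruct l; apply injective_projections; simpl; unfold scal; simpl; unfold mult; simpl; ring).
assert (Ht : Rabs (t - t) < d) by (rewrite Rminus_diag, Rabs_R0; lra).
destruct (Rtotal_order y t) as [Hl|[->|Hl]].
- rewrite (Rabs_left (y - t)) by lra.
  replace (g y - g t - RtoC (y - t) * l)%C
    with (- (g t - g y - RtoC (t - y) * l))%C by (rewrite !RtoC_minus; ring).
  rewrite Cmod_opp; replace (- (y - t)) with (t - y) by ring.
  apply Bd; auto; lra.
- replace (g t - g t - RtoC (t - t) * l)%C with (RtoC 0) by (rewrite Rminus_diag; ring).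
  rewrite Cmod_0, Rminus_diag, Rabs_R0; lra.
- rewrite (Rabs_pos_eq (y - t)) by lra; apply Bd; auto; lra.
Qed.

Theorem theorem3p2 :
  forall (H : HilbertSpace) (M : BOp H -> Prop) (E : BOp H -> C)
    (A : R -> BOp H -> Prop) (W : R -> BOp H)
    (a b c : R -> C) (t0 : R) (X : R -> BOp H),
  W_probability_space M E ->
  filtration M A ->
  free_brownian_motion E A W ->
  locally_operator_Lipschitz a ->
  locally_operator_Lipschitz b ->
  locally_operator_Lipschitz c ->
  free_SDE_solution A W a b c t0 X ->
  (exists B : R, forall t, 0 <= t < t0 -> op_norm (X t) <= B) ->
  forall (z : C) (G aX bX cX : R -> BOp H),
  Im z <> 0 ->
  (forall t, 0 <= t < t0 ->
     is_resolvent (X t) z (G t) /\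
     is_fun_calc a (X t) (aX t) /\
     is_fun_calc b (X t) (bX t) /\
     is_fun_calc c (X t) (cX t)) ->
  forall t, 0 <= t < t0 ->
  is_derive_within (fun s => 0 <= s < t0) (fun s => E (G s)) t
    (- E (aX t ** op_pow (G t) 2)
     + E (bX t ** cX t ** G t) * E (bX t ** cX t ** op_pow (G t) 2))%C.
Proof.
intros H M E A W a b c t0 X HE HA HW La Lb Lc [HX [CX [aX' [bX' [cX' [Hcalc Heq]]]]]] [B HB]
  z G aX bX cX Hz HG t Ht.
pose proof (wps_algebra _ _ HE) as HM.
(* The trace separates 1 from 0, so the space is nonzero and testing on scalar operators is
   meaningful. *)
assert (H1 : (op_one : BOp H) <> op_zero).
{ intros Z; pose proof (wps_one _ _ HE) as E1; rewrite Z, (E_zero M E HE) in E1.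
  apply RtoC_inj in E1; lra. }
assert (Lip : forall f (F : R -> BOp H), locally_operator_Lipschitz f ->
  (forall p, 0 <= p < t0 -> is_fun_calc f (X p) (F p)) ->
  (forall p, 0 <= p < t0 -> A p (F p)) /\
  exists L, 0 <= L /\ forall p, 0 <= p < t0 ->
    op_norm (minus (F p) (F t)) <= L * op_norm (minus (X p) (X t))).
{ intros f F Lf HF; split.
  - intros p Hp; apply (vn_fun_calc (A p) f (X p)); auto.
    + apply (filt_algebra _ _ HA); lra.
    + now apply (locally_operator_Lipschitz_scalar (H := H)).
    + now apply HX.
  - destruct Lf as [_ [_ Lf]]; pose proof (Rabs_pos B); pose proof (Rle_abs B).
    destruct (Lf (Rabs B + 1)) as [L [HL BL]]; [lra|].
    exists L; split; [lra|]; intros p Hp.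
    pose proof (HB p Hp); pose proof (HB t Ht).
    apply BL; try lra; try apply HX; auto. }
destruct (Lip a aX La) as [Aa [ka [Hka Ba]]]; [intros p Hp; apply HG, Hp|].
destruct (Lip b bX Lb) as [Ab [kb [Hkb Bb]]]; [intros p Hp; apply HG, Hp|].
destruct (Lip c cX Lc) as [Ac [kc [Hkc Bc]]]; [intros p Hp; apply HG, Hp|].
assert (Ea : forall p, 0 <= p < t0 -> aX' p = aX p).
{ intros p Hp; apply (fun_calc_unique a (X p)); auto; [apply HX|apply Hcalc|apply HG]; auto. }
assert (Eb : forall p, 0 <= p < t0 -> bX' p = bX p).
{ intros p Hp; apply (fun_calc_unique b (X p)); auto; [apply HX|apply Hcalc|apply HG]; auto. }
assert (Ec : forall p, 0 <= p < t0 -> cX' p = cX p).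
{ intros p Hp; apply (fun_calc_unique c (X p)); auto; [apply HX|apply Hcalc|apply HG]; auto. }
(* The coefficients inside [free_SDE_solution] agree with the given ones on [[0, t0)] only, so the
   tags of each partition must be shown to lie in [[0, p]]. *)
assert (Sol : forall p, 0 <= p < t0 -> exists I J : BOp H,
  is_RInt aX 0 p I /\ is_free_integral W bX cX 0 p J /\ X p = plus (X 0) (plus I J)).
{ intros p Hp; destruct (Heq p Hp) as [I [J [HI [HJ EX]]]].
  exists I, J; split; [|split; [|exact EX]].
  - apply (is_RInt_ext aX'); [|exact HI]; intros x.
    rewrite Rmin_left, Rmax_right by lra; intros Hx; apply Ea; lra.
  - intros e He; destruct (HJ e He) as [d [Hd Bd]]; exists d; split; [exact Hd|].
    intros n u tau U0 Un Hu; specialize (Bd n u tau U0 Un Hu).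
    assert (Mon : forall i, (i <= n)%nat -> u i <= p).
    { intros i Hi; rewrite <- Un; clear Bd U0 Un.
      induction Hi as [|m Hi IH]; [lra|].
      specialize (IH ltac:(intros j Hj; apply Hu; lia)).
      destruct (Hu (S m) ltac:(lia)) as [Q _]; simpl in Q; lra. }
    replace (sum_n_m (fun i => bX (tau i) ** minus (W (u i)) (W (u (pred i))) ** cX (tau i)) 1 n)
      with (sum_n_m (fun i => bX' (tau i) ** minus (W (u i)) (W (u (pred i))) ** cX' (tau i)) 1 n);
      [exact Bd|].
    apply sum_n_m_ext_loc; intros i Hi; destruct (Hu i Hi) as [_ [Q _]].
    pose proof (Mon (pred i) ltac:(lia)); now rewrite Eb, Ec by lra. }
set (g := op_norm (G t)); pose proof (op_norm_ge_0 (G t)) as Hg; fold g in Hg.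
(* The leading 1 absorbs a deviation [eta <= 1], so [K] bounds the coefficients and resolvents
   throughout a neighbourhood of [t]. *)
set (K := 1 + op_norm (aX t) + op_norm (bX t) + op_norm (cX t) + g).
pose proof (op_norm_ge_0 (aX t)) as Na; pose proof (op_norm_ge_0 (bX t)) as Nb.
pose proof (op_norm_ge_0 (cX t)) as Nc.
assert (HK : 1 <= K) by (unfold K; lra).
assert (HC : 0 < resolvent_constant K).
{ assert (0 < K) by lra; unfold resolvent_constant.
  clearbody K; repeat first [lra | apply pow_lt | apply Rmult_lt_0_compat | apply Rplus_lt_0_compat]. }
(* The last term dominates both [2 * g ^ 2], the Lipschitz constant of the resolvent, and [2 * g],
   which ensures the smallness required there. *)
set (L := 1 + ka + kb + kc + 2 * (g + 1) ^ 2).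
assert (HL : 1 <= L) by (unfold L; pose proof (pow2_ge_0 (g + 1)); lra).
apply is_derive_within_epsilon; [exact Ht|]; intros e He.
set (eta := Rmin 1 (e / resolvent_constant K)).
assert (Heta : 0 < eta) by (apply Rmin_pos; [lra|now apply Rdiv_lt_0_compat]).
pose proof (Rmin_l 1 (e / resolvent_constant K)) as Heta1; fold eta in Heta1.
pose proof (Rmin_r 1 (e / resolvent_constant K)) as Heta2; fold eta in Heta2.
assert (Hrho : 0 < eta / L) by (apply Rdiv_lt_0_compat; lra).
destruct (CX t Ht (fun T => op_norm (minus T (X t)) < eta / L)) as [d Hd].
{ exists (mkposreal _ Hrho); intros T HT; exact HT. }
assert (Near : forall p, 0 <= p < t0 -> Rabs (p - t) < d ->
  op_norm (minus (X p) (X t)) <= eta /\ op_norm (minus (aX p) (aX t)) <= eta /\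
  op_norm (minus (bX p) (bX t)) <= eta /\ op_norm (minus (cX p) (cX t)) <= eta /\
  op_norm (minus (G p) (G t)) <= eta).
{ intros p Hp Hpt; specialize (Hd p Hpt Hp); simpl in Hd.
  pose proof (op_norm_ge_0 (minus (X p) (X t))) as N0.
  set (rho := op_norm (minus (X p) (X t))) in *.
  assert (LR : L * rho <= eta).
  { replace eta with (L * (eta / L)) by (field; lra); apply Rmult_le_compat_l; lra. }
  assert (Small : forall k, k <= L -> k * rho <= eta).
  { intros k Hk; apply Rle_trans with (L * rho); [now apply Rmult_le_compat_r|exact LR]. }
  assert (Q : 0 <= 2 * (g + 1) ^ 2) by (pose proof (pow2_ge_0 (g + 1)); lra).
  repeat split.
  - rewrite <- (Rmult_1_l rho); apply Small; lra.
  - eapply Rle_trans; [now apply Ba|apply Small; unfold L; lra].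
  - eapply Rle_trans; [now apply Bb|apply Small; unfold L; lra].
  - eapply Rle_trans; [now apply Bc|apply Small; unfold L; lra].
  - eapply Rle_trans.
    + apply (resolvent_lipschitz (X t) (X p) (G t) (G p) z); [apply HG, Ht|apply HG, Hp|].
      fold rho g; pose proof (Small (2 * g) ltac:(unfold L; simpl; nra)); lra.
    + fold rho g; apply Small; unfold L; simpl; nra. }
(* Two distances below [eta / 2] give [r - s <= eta], the step size that [resolvent_increment]
   allows. *)
exists (Rmin d (eta / 2)); split; [apply Rmin_pos; [apply cond_pos|lra]|].
intros s r Ds Dr Hsr Htsr Hs Hr.
pose proof (Rmin_l d (eta / 2)); pose proof (Rmin_r d (eta / 2)).
destruct (Sol s Ds) as [I1 [J1 [HI1 [HJ1 EX1]]]].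
destruct (Sol r Dr) as [I2 [J2 [HI2 [HJ2 EX2]]]].
apply Rabs_def2 in Hs, Hr.
eapply Rle_trans.
- apply (resolvent_increment M E A W HE HA HW X G aX bX cX z (X 0) I1 I2 J1 J2 t s r K eta);
    auto; try lra.
  intros p Hp; assert (Dp : 0 <= p < t0) by lra.
  destruct (Near p Dp) as [DX [Da [Db [Dc DG]]]]; [apply Rabs_def1; lra|].
  destruct (HX p Dp) as [AX SX].
  repeat split; auto; try apply (HG p Dp).
  + eapply Rle_trans; [apply (op_norm_near (aX t) _ _ _ (Rle_refl _) Da)|unfold K; lra].
  + eapply Rle_trans; [apply (op_norm_near (bX t) _ _ _ (Rle_refl _) Db)|unfold K; lra].
  + eapply Rle_trans; [apply (op_norm_near (cX t) _ _ _ (Rle_refl _) Dc)|unfold K; lra].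
  + eapply Rle_trans; [apply (op_norm_near (G t) _ _ _ (Rle_refl _) DG)|unfold K; fold g; lra].
- apply Rmult_le_compat_r; [lra|].
  apply Rle_trans with (resolvent_constant K * (e / resolvent_constant K)).
  + apply Rmult_le_compat_l; lra.
  + right; field; lra.
Qed.
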